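(* Let $\bm{Y}_1,\dots,\bm{Y}_\zeta$ be complex $n\times n$ matrices. Suppose that, for every $j=1,2,\dots,\zeta+1$, $(\bm{X}_{j,\ell_j})_{\ell_j}$ is a sequence of complex $n\times n$ matrices with $\bm{X}_{j,\ell_j}\rightarrow\bm{X}_j$, and assume that all partial derivatives of the function $\beta^{[\zeta+1]}$ up to any order are bounded. Then $$T_{\beta^{[\zeta]}}^{\bm{X}_{1, \ell_1},\ldots,\bm{X}_{\zeta+1,\ell_{\zeta+1}}}(\bm{Y}_1,\ldots,\bm{Y}_{\zeta})\rightarrow T_{\beta^{[\zeta]}}^{\bm{X}_1,\ldots,\bm{X}_{\zeta+1}}(\bm{Y}_1,\ldots,\bm{Y}_{\zeta}).$$ Here all convergences are in the Frobenius norm, as the indices $\ell_j\to\infty$.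
   Context: Jordan data: every complex $n\times n$ matrix $\bm{X}_p$ is written as $\bm{X}_p=\sum_{k_p=1}^{K_p}\sum_{i_p=1}^{\alpha^{\mathrm G}_{k_p}}\left(\lambda_{k_p}\bm{P}_{k_p,i_p}+\bm{N}_{k_p,i_p}\right)$, where $\lambda_{k_p}$ are the $K_p$ distinct eigenvalues, $\alpha^{\mathrm G}_{k_p}$ is the geometric multiplicity of $\lambda_{k_p}$ (the number of its Jordan blocks), $\bm{P}_{k_p,i_p}$ is the projector onto the invariant subspace of the $i_p$-th Jordan block of $\lambda_{k_p}$ (so $\sum_{k_p,i_p}\bm{P}_{k_p,i_p}=\bm{I}$), and $\bm{N}_{k_p,i_p}$ is the nilpotent part of that block, of order $m_{k_p,i_p}$ (i.e. $\bm{N}_{k_p,i_p}^{\ell}=\bm{0}$ for $\ell\ge m_{k_p,i_p}$). Put $\bm{S}^{(0)}_{k_p,i_p}=\bm{P}_{k_p,i_p}$ and $\bm{S}^{(q)}_{k_p,i_p}=\bm{N}_{k_p,i_p}^{q}$ for $q\ge1$. Generalized multiple operator integral (GMOI): for a function $g$ of $\zeta+1$ complex variables, analytic near the relevant eigenvalue tuples, $$T_{g}^{\bm{X}_1,\ldots,\bm{X}_{\zeta+1}}(\bm{Y}_1,\ldots,\bm{Y}_{\zeta})=\sum_{k_1,\dots,k_{\zeta+1}}\sum_{i_1,\dots,i_{\zeta+1}}\sum_{q_1=0}^{m_{k_1,i_1}-1}\cdots\sum_{q_{\zeta+1}=0}^{m_{k_{\zeta+1},i_{\zeta+1}}-1}\frac{g^{(q_1,\dots,q_{\zeta+1})}(\lambda_{k_1},\dots,\lambda_{k_{\zeta+1}})}{q_1!\cdots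 q_{\zeta+1}!}\,\bm{S}^{(q_1)}_{k_1,i_1}\bm{Y}_1\cdots\bm{Y}_\zeta\bm{S}^{(q_{\zeta+1})}_{k_{\zeta+1},i_{\zeta+1}},$$ where $g^{(q_1,\dots,q_{\zeta+1})}$ is the partial derivative of order $q_l$ in the $l$-th variable. Divided differences: $\beta$ is a function of one complex variable, analytic on a domain containing all spectra involved; $\beta^{[0]}=\beta$ and $\beta^{[\ell]}(z_0,\dots,z_\ell)=\dfrac{\beta^{[\ell-1]}(z_0,z_2,\dots,z_\ell)-\beta^{[\ell-1]}(z_1,z_2,\dots,z_\ell)}{z_0-z_1}$, extended by continuity to coincident arguments; $\beta^{[\ell]}$ is a symmetric function of $\ell+1$ variables. *)

(* Defs.v *)
From HB Require Import structures.
From mathcomp Require Import all_boot all_order all_algebra.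
From mathcomp Require Import complex.
From mathcomp Require Import all_classical all_reals all_analysis.

Set Implicit Arguments.
Unset Strict Implicit.
Unset Printing Implicit Defensive.

Import Order.TTheory GRing.Theory Num.Theory.
Import numFieldNormedType.Exports.

Local Open Scope classical_set_scope.
Local Open Scope ring_scope.
Local Open Scope complex_scope.

(* The complex numbers over the reals R, as a numClosedFieldType so that the
   topology and normed-module structure of numFieldNormedType apply. *)
Definition Cplx (R : realType) : numClosedFieldType := R[i].

Section JordanData.
Context {R : realType} {n : nat}.
Local Notation C := (Cplx R).
Implicit Type X : 'M[C]_n.

Definition geom_mult X (a : C) : nat := \rank (eigenspace X a).

(* A Jordan decomposition of X.  Because the i-th index of the eigenvalue
   jlam k ranges over exactly geom_mult X (jlam k) values and the range of
   jP k i has dimension jm k i, each block is a single Jordan block of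
   size jm k i.  Eigenspaces are those of the library (row vectors); a matrix
   and its transpose have the same eigenvalues and geometric multiplicities. *)
Record jordan_data X := JordanData {
  jK : nat;
  jlam : 'I_jK -> C;
  jlam_inj : injective jlam;
  jlam_spectrum : forall a : C, eigenvalue X a <-> exists k, jlam k = a;
  jm : forall k : 'I_jK, 'I_(geom_mult X (jlam k)) -> nat;
  jP : forall k : 'I_jK, 'I_(geom_mult X (jlam k)) -> 'M[C]_n;
  jN : forall k : 'I_jK, 'I_(geom_mult X (jlam k)) -> 'M[C]_n;
  jP_idem : forall k i, jP (k := k) i *m jP i = jP i;
  jP_orth : forall k i k' i',
    Tagged (fun k => 'I_(geom_mult X (jlam k))) i !=
      Tagged (fun k => 'I_(geom_mult X (jlam k))) i' ->
    jP (k := k) i *m jP (k := k') i' = 0;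
  jP_sum : \sum_(k < jK) \sum_i jP (k := k) i = 1%:M;
  jP_rank : forall k i, \rank (jP (k := k) i) = jm i;
  jPN : forall k i, jP (k := k) i *m jN i = jN i;
  jNP : forall k i, jN (k := k) i *m jP i = jN i;
  jN_nilp : forall k i l, (jm (k := k) i <= l)%N -> jN i ^+ l = 0;
  jN_order : forall k i l, (l < jm (k := k) i)%N -> jN i ^+ l != 0;
  jX_sum : X = \sum_(k < jK) \sum_i (jlam k *: jP (k := k) i + jN i)
}.

Definition jS X (D : jordan_data X) (k : 'I_(jK D))
    (i : 'I_(geom_mult X (jlam k))) (q : nat) : 'M[C]_n :=
  if q is 0%N then jP i else jN i ^+ q.

End JordanData.

Section Functions.
Context {R : realType}.
Local Notation C := (Cplx R).

Definition partial_derive {d : nat} (p : 'I_d.+1) (g : 'rV[C]_d.+1 -> C) :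
    'rV[C]_d.+1 -> C :=
  fun z => 'D_(delta_mx 0 p) g z.

Definition mixed_derive {d : nat} (q : 'I_d.+1 -> nat)
    (g : 'rV[C]_d.+1 -> C) : 'rV[C]_d.+1 -> C :=
  foldr (fun p h => iter (q p) (partial_derive p) h) g (enum 'I_d.+1).

(* Divided difference at the nonempty list of nodes z0 :: s.  When the first
   two nodes coincide, the value is the extension by continuity in the first
   node. *)
Fixpoint divdiff_seq (beta : C -> C) (z0 : C) (s : seq C) : C :=
  if s is z1 :: s' then
    if z0 != z1 then
      (divdiff_seq beta z0 s' - divdiff_seq beta z1 s') / (z0 - z1)
    else
      lim ((divdiff_seq beta w s' - divdiff_seq beta z1 s') / (w - z1)
             @[w --> z1^'])
  else beta z0.

Definition divdiff (d : nat) (beta : C -> C) (z : 'rV[C]_d.+1) : C :=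
  divdiff_seq beta (z 0 ord0) [seq z 0 (lift ord0 p) | p <- enum 'I_d].

Definition analytic_on (Omega : set C) (f : C -> C) : Prop :=
  forall c, Omega c -> exists a : nat -> C,
    \forall z \near c, series (fun k => a k * (z - c) ^+ k) @ \oo --> f z.

Definition complex_domain (Omega : set C) : Prop :=
  [/\ Omega !=set0, open Omega & connected Omega].

End Functions.

Section GMOI.
Context {R : realType} {n zeta : nat}.
Local Notation C := (Cplx R).

Definition fnorm (A : 'M[C]_n) : R :=
  Num.sqrt (\sum_i \sum_j Normc.normc (A i j) ^+ 2).

Definition gmoi (g : 'rV[C]_zeta.+1 -> C) (X : 'I_zeta.+1 -> 'M[C]_n)
    (D : forall p, jordan_data (X p)) (Y : 'I_zeta -> 'M[C]_n) :
    'M[C]_n :=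
  \sum_(k : {dffun forall p : 'I_zeta.+1, 'I_(jK (D p))})
  \sum_(i : {dffun forall p : 'I_zeta.+1, 'I_(geom_mult (X p) (jlam (k p)))})
  \sum_(q : {dffun forall p : 'I_zeta.+1, 'I_(jm (i p))})
    (mixed_derive (fun p => q p : nat) g (\row_p jlam (k p))
       / \prod_p ((q p : nat)`!)%:R)
    *: (jS (i ord0) (q ord0) *m
        \big[mulmx/1%:M]_(p < zeta)
          (Y p *m jS (i (lift ord0 p)) (q (lift ord0 p)))).

End GMOI.

(* Main.v *)
Require Import Defs.
From mathcomp Require Import all_boot all_order all_algebra.
From mathcomp Require Import complex.
From mathcomp Require Import all_classical all_reals all_analysis.
From mathcomp Require Import ring.

Set Implicit Arguments.
Unset Strict Implicit.
Unset Printing Implicit Defensive.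

Import Order.TTheory GRing.Theory Num.Theory.
Import numFieldNormedType.Exports.

Local Open Scope classical_set_scope.
Local Open Scope ring_scope.
Local Open Scope complex_scope.

(* A derivative of a divided difference with respect to a node is a divided
   difference with that node repeated, so up to factorials the coefficients of
   the GMOI of beta^[zeta] are divided differences of beta at repeated
   eigenvalues.  The recurrence of divided differences then turns the sum over
   the Jordan blocks of each X_p into Newton's interpolation form
     sum_(j < n) beta[mu_0, ..., mu_j, rest] (X_p - mu_0) ... (X_p - mu_(j-1)),
   where mu_0, ..., mu_(n-1) lists the roots of the characteristic polynomial
   in any order; the remainder vanishes by Cayley-Hamilton.  This form involves
   no Jordan data, and it is continuous: the divided differences of an analytic
   function are jointly continuous in their nodes, and the roots of the
   characteristic polynomials can be numbered so as to converge. *)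

(** Jordan data do not pass to the limit: when eigenvalues merge, the blocks change, and the
    projectors of the approximating matrices may be unbounded. The GMOI therefore cannot be compared
    term by term; only the sum over all blocks of a matrix is stable. The resummation rests on two
    properties of divided differences, symmetry and the recurrence cleared of its denominator, both
    needed at repeated nodes. Symmetry is not formal there, because [divdiff_seq] takes a limit
    whenever two leading nodes coincide; it is obtained at distinct points and extended by
    continuity in one node. Joint continuity follows from local boundedness: moving one node changes
    a divided difference by the displacement times a divided difference with one node more. The
    quantitative input is a bound at distinct clustered nodes, read off a power series. *)

(** * Generalities on limits *)

Lemma cvg_near_eq (T : Type) (U : topologicalType) (F : set_system T)
    {FF : Filter F} (f g : T -> U) (l : U) :
  (\forall t \near F, f t = g t) -> g @ F --> l -> f @ F --> l.
Proof.
by move=> fg; apply: cvg_trans; apply: near_eq_cvg; apply: filterS fg => t ->.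
Qed.

Lemma norm_cvg_le (K : numFieldType) (T : Type) (F : set_system T)
    {FF : ProperFilter F} (f : T -> K) (l M : K) :
  (\forall t \near F, `|f t| <= M) -> f @ F --> l -> `|l| <= M.
Proof.
move=> fM /cvgrPdist_lt fl; apply/ler_addgt0Pr => e e0.
have [t [fMt lft]] := filter_ex (filterI fM (fl e e0)).
rewrite -[l](subrK (f t)) addrC (le_trans (ler_normD _ _))//.
by rewrite lerD// ltW.
Qed.

Lemma cvg_dnbhs (T U : topologicalType) (f : T -> U) (a : T) (l : U) :
  f @ a --> l -> f @ a^' --> l.
Proof. exact: cvg_within_filter. Qed.

Lemma cvg_norm_ge (K : numFieldType) (T : Type) (F : set_system T)
    {FF : Filter F} (f : T -> K) (l : K) : l != 0 -> f @ F --> l ->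
  \forall t \near F, `|l| / 2 <= `|f t|.
Proof.
move=> l0 /cvgrPdist_lt fl.
have d0 : 0 < `|l| / 2 by rewrite divr_gt0// normr_gt0.
apply: filterS (fl _ d0) => t lft.
have := ler_normD (l - f t) (f t); rewrite subrK.
rewrite [X in X <= _ -> _]splitr => h; have := le_trans h (lerD (ltW lft) (lexx _)).
by rewrite lerD2l.
Qed.

Lemma cvg_sumr (K : numFieldType) (T I : Type) (F : set_system T)
    {FF : Filter F} (r : seq I) (f : T -> I -> K) (l : I -> K) :
  (forall i, f t i @[t --> F] --> l i) ->
  \sum_(i <- r) f t i @[t --> F] --> \sum_(i <- r) l i.
Proof.
move=> fl; elim: r => [|i r IHr].
  by under eq_fun do rewrite big_nil; rewrite big_nil; exact: cvg_cst.
under eq_fun do rewrite big_cons; rewrite big_cons.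
by apply: cvgD; [exact: fl | exact: IHr].
Qed.

(** * Divided differences of power series at distinct nodes *)

Section DividedDifferences.
Context {R : realType}.
Local Notation C := (Cplx R).
Implicit Types (f g h : C -> C) (s : seq C).

(** The value 0 at the empty list lets [dd_mulr_sub] hold for a single node. *)
Definition dd f s : C := if s is z :: s' then divdiff_seq f z s' else 0.

Lemma dd_rec f z0 z1 s : z0 != z1 ->
  dd f [:: z0, z1 & s] = (dd f (z0 :: s) - dd f (z1 :: s)) / (z0 - z1).
Proof. by move=> z01 /=; rewrite z01. Qed.

(** Leibniz rule with two terms only, since a linear factor has vanishing divided differences of
    order two and more. *)
Lemma dd_mulr_sub f c z0 s : uniq (z0 :: s) ->
  dd (fun x => (x - c) * f x) (z0 :: s) =
    (z0 - c) * dd f (z0 :: s) + dd f s.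
Proof.
elim: s z0 => [|z1 s IHs] z0; first by rewrite /= addr0.
rewrite [uniq _]/= inE negb_or => /and3P[/andP[z01 z0s] z1s us].
rewrite !dd_rec// !IHs ?[uniq _]/= ?z0s ?z1s//.
have : z0 - z1 != 0 by rewrite subr_eq0.
by move=> z; field.
Qed.

Lemma dd_sum (a : nat -> C) (e : nat -> C -> C) n s : uniq s ->
  dd (fun x => \sum_(k < n) a k * e k x) s = \sum_(k < n) a k * dd (e k) s.
Proof.
case: s => [_|z0 s]; first by rewrite big1// => k _; rewrite mulr0.
elim: s z0 => [//|z1 s IHs] z0.
rewrite [uniq _]/= inE negb_or => /and3P[/andP[z01 z0s] z1s us].
rewrite dd_rec// !IHs ?[uniq _]/= ?z0s ?z1s// -sumrB mulr_suml.
by apply: eq_bigr => k _; rewrite dd_rec// -mulrBr mulrA.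
Qed.

(** At distinct nodes a divided difference is a fixed linear combination of values, so pointwise
    convergence suffices. *)
Lemma dd_cvg (u : nat -> C -> C) f s : uniq s ->
  (forall z, z \in s -> u n z @[n --> \oo] --> f z) ->
  dd (u n) s @[n --> \oo] --> dd f s.
Proof.
case: s => [_ _|z0 s]; first exact: cvg_cst.
elim: s z0 => [|z1 s IHs] z0.
  by move=> _ uf; apply: uf; rewrite mem_head.
rewrite [uniq _]/= inE negb_or => /and3P[/andP[z01 z0s] z1s us] uf.
rewrite dd_rec//; under eq_fun do rewrite dd_rec//.
apply: cvgM; last exact: cvg_cst.
by apply: cvgB; apply: IHs => [|z]; rewrite ?[uniq _]/= ?z0s ?z1s ?us// inE => zs;
  apply: uf; rewrite !inE; case/orP: zs => ->; rewrite ?orbT.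
Qed.

(* The factor r ^+ size s makes the bound stable under dd_mulr_sub. *)
Lemma dd_monomial_le (r c : C) k s : 0 < r -> uniq s ->
  (forall z, z \in s -> `|z - c| < r) ->
  `|dd (fun x => (x - c) ^+ k) s| * r ^+ size s <= r * (2 * r) ^+ k.
Proof.
move=> r0.
have dd0 n : `|dd (fun x => (x - c) ^+ n) [::]| * r ^+ size (@nil C) <=
    r * (2 * r) ^+ n.
  by rewrite /= normr0 mul0r mulr_ge0 ?exprn_ge0 ?mulr_ge0// ltW.
elim: k s => [|k IHk] [|z0 s]// us zr.
- rewrite expr0 mulr1; case: s us zr => [|z1 s] us zr.
    by rewrite /= expr0 normr1 mul1r expr1.
  suff -> : dd (fun x => (x - c) ^+ 0) [:: z0, z1 & s] = 0.
    by rewrite normr0 mul0r ltW.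
  elim: s z0 z1 us {zr} => [|z2 s IHs] z0 z1.
    rewrite [uniq _]/= inE andbT => z01.
    by rewrite dd_rec//= !expr0 subrr mul0r.
  rewrite [uniq _]/= !inE !negb_or -!andbA.
  case/and5P=> z01 z02 z0s z12 /and3P[z1s z2s us].
  by rewrite dd_rec// !IHs ?subrr ?mul0r//= inE negb_or ?z02 ?z0s ?z12 ?z1s ?z2s.
- have -> : (fun x => (x - c) ^+ k.+1) = (fun x => (x - c) * (x - c) ^+ k).
    by apply: funext => x; rewrite exprS.
  rewrite dd_mulr_sub//.
  have h1 := IHk _ us zr.
  have h2 : `|dd (fun x => (x - c) ^+ k) s| * r ^+ size s <= r * (2 * r) ^+ k.
    apply: IHk => [|z zs]; first by case/andP: us.
    by apply: zr; rewrite inE zs orbT.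
  have zc : `|z0 - c| <= r by rewrite ltW// zr// mem_head.
  apply: (@le_trans _ _ (r * (`|dd (fun x => (x - c) ^+ k) (z0 :: s)| *
      r ^+ size (z0 :: s)) + r * (`|dd (fun x => (x - c) ^+ k) s| * r ^+ size s))).
    rewrite [X in _ <= _ + X]mulrCA -[r * r ^+ _]exprS mulrA -mulrDl.
    rewrite ler_wpM2r ?exprn_ge0 ?(ltW r0)// (le_trans (ler_normD _ _))//.
    by rewrite lerD2r normrM ler_wpM2r.
  rewrite [_ ^+ k.+1]exprS.
  have -> : r * (2 * r * (2 * r) ^+ k) = r * (r * (2 * r) ^+ k) +
     r * (r * (2 * r) ^+ k) by ring.
  by rewrite lerD// ler_wpM2l// ltW.
Qed.

Lemma geometric_half_le n : \sum_(k < n) (2^-1 : C) ^+ k <= 2.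
Proof.
suff -> : \sum_(k < n) (2^-1 : C) ^+ k = 2 - 2 * 2^-1 ^+ n.
  by rewrite gerBl mulr_ge0// exprn_ge0// invr_ge0.
elim: n => [|n IHn]; first by rewrite big_ord0 expr0 mulr1 subrr.
by rewrite big_ord_recr/= IHn exprS; field.
Qed.

(** Convergence at the single point [c + r] forces the terms [a k * r ^+ k] to tend to 0, hence to
    be bounded; this stands in for Cauchy's estimates. *)
Lemma power_series_coef_le (a : nat -> C) (c : C) f :
  (\forall z \near c, series (fun k => a k * (z - c) ^+ k) @ \oo --> f z) ->
  exists r A : C, [/\ 0 < r, forall k, `|a k| * r ^+ k <= A &
    forall z, `|z - c| < r -> series (fun k => a k * (z - c) ^+ k) @ \oo --> f z].
Proof.
move=> /nbhs_normP[e /= e0 ef]; pose r := e / 2.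
have r0 : 0 < r by rewrite divr_gt0.
have re : r < e by rewrite ltr_pdivrMr// mulr_natr mulr2n ltrDl.
have cvr : cvgn (series (fun k => a k * r ^+ k)).
  apply/cvg_ex; exists (f (c + r)).
  have := ef (c + r); rewrite /= opprD addNKr normrN gtr0_norm// => /(_ re).
  by rewrite addrC addKr.
have [A [Areal A1]] := cvg_seq_bounded (cvgP _ (cvg_series_cvg_0 cvr)).
(* [A] itself need not be a bound: boundedness is stated for every value above it. *)
have AA1 : A < `|A| + 1.
  by rewrite (le_lt_trans (real_ler_norm Areal))// ltrDl.
exists r, (`|A| + 1); split; first exact: r0.
  move=> k; have /= := A1 _ AA1 k I.
  by rewrite normrM normrX (gtr0_norm r0).
by move=> z zr; apply: ef; rewrite /= distrC (lt_trans zr).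
Qed.

(** The bound does not see how close the nodes are to each other, which is what survives when nodes
    merge. It is proved for partial sums and passes to the limit by [dd_cvg]. *)
Lemma dd_power_series_le (a : nat -> C) (c : C) f :
  (\forall z \near c, series (fun k => a k * (z - c) ^+ k) @ \oo --> f z) ->
  exists r A : C, 0 < r /\ forall s, uniq s ->
    (forall z, z \in s -> `|z - c| < r) -> `|dd f s| * r ^+ size s <= A.
Proof.
move=> /power_series_coef_le[r [A [r0 aA fs]]].
(* The factor [(2 * d) ^+ k] of [dd_monomial_le] is [r ^+ k] times [2^-1 ^+ k], so the terms are
   dominated by a geometric series of sum at most 2, whence the constant [A * d * 2]. *)
pose d := r / 4; have d0 : 0 < d by rewrite divr_gt0.
have rd : r = 4 * d by rewrite /d; field.
have dr : d <= r by rewrite rd ler_peMl ?ler1n// ltW.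
exists d, (A * d * 2); split => // s us sd.
pose u n (x : C) := \sum_(k < n) a k * (x - c) ^+ k.
have uf : dd (u n) s @[n --> \oo] --> dd f s.
  apply: dd_cvg => // z /sd zd.
  have := fs _ (lt_le_trans zd dr); rewrite /series /=.
  by under eq_fun do rewrite big_mkord.
have ud : (fun n => dd (u n) s * d ^+ size s) @ \oo --> dd f s * d ^+ size s.
  by apply: cvgM; [exact: uf | exact: cvg_cst].
suff : `|dd f s * d ^+ size s| <= A * d * 2.
  by rewrite normrM normrX (gtr0_norm d0).
apply: norm_cvg_le ud; apply: nearW => n.
rewrite /u (@dd_sum a (fun k x => (x - c) ^+ k))// mulr_suml.
rewrite (le_trans (ler_norm_sum _ _ _))//.
have A0 : 0 <= A.
  by apply: le_trans (aA 0%N); rewrite mulr_ge0 ?exprn_ge0// ltW.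
apply: (@le_trans _ _ (\sum_(k < n) A * d * (2^-1) ^+ k)); last first.
  rewrite -mulr_sumr ler_wpM2l ?geometric_half_le// mulr_ge0//.
  exact: ltW.
apply: ler_sum => k _; rewrite !normrM normrX (gtr0_norm d0) -mulrA.
apply: (le_trans (ler_wpM2l (normr_ge0 _) (dd_monomial_le k d0 us sd))).
have -> : 2 * d = r * 2^-1 by rewrite rd; field.
rewrite exprMn; have -> : `|a k| * (d * (r ^+ k * 2^-1 ^+ k)) =
  `|a k| * r ^+ k * (d * 2^-1 ^+ k) by ring.
rewrite -(mulrA A) ler_wpM2r// mulr_ge0 ?exprn_ge0 ?invr_ge0//.
exact: ltW.
Qed.

End DividedDifferences.

(** * Divided differences of analytic functions *)

Lemma cvg0_mul_bounded (K : numFieldType) (T : Type) (F : set_system T)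
    {FF : Filter F} (u v : T -> K) (M : K) :
  u @ F --> 0 -> (\forall t \near F, `|v t| <= M) -> u t * v t @[t --> F] --> 0.
Proof.
move=> u0 vM; apply/cvgr0Pnorm_lt => e e0.
have M0 : 0 < `|M| + 1 by rewrite ltr_wpDl.
near=> t.
have ut : `|u t| < e / (`|M| + 1).
  by near: t; move/cvgr0Pnorm_lt: u0; apply; rewrite divr_gt0.
have vt : `|v t| <= `|M| + 1.
  have vt : `|v t| <= M by near: t.
  rewrite (le_trans vt)// (le_trans (real_ler_norm _)) ?lerDl//.
  by rewrite ger0_real// (le_trans (normr_ge0 _) vt).
rewrite normrM (le_lt_trans (ler_wpM2l (normr_ge0 _) vt))//.
by rewrite -ltr_pdivlMr.
Unshelve. all: by end_near. Qed.

(** * Finite Taylor expansions and difference quotients *)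

Section TaylorExpandable.
Context {R : realType}.
Local Notation C := (Cplx R).
Implicit Types (g : C -> C) (c a : C).

(* Passes to difference quotients (taylor_dquot) by elementary algebra, whereas
   complex differentiability would need Cauchy's integral formula. *)
Fixpoint taylor_expandable N c g : Prop :=
  if N is N'.+1 then exists2 g1, taylor_expandable N' c g1 &
    \forall w \near c, g w = g c + (w - c) * g1 w
  else exists M, \forall w \near c, `|g w| <= M.

Lemma taylor_near_eq N c g g' : (\forall w \near c, g w = g' w) ->
  taylor_expandable N c g -> taylor_expandable N c g'.
Proof.
move=> gg'; case: N => [|N] /= [M gM]; last move=> p.
  by exists M; apply: filterS2 gg' gM => w ->.
by exists M => //; apply: filterS2 (gg') p => w <-; rewrite (nbhs_singleton gg').
Qed.

Lemma taylor_addr N c g k :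
  taylor_expandable N c g -> taylor_expandable N c (fun w => g w + k).
Proof.
case: N => [|N] /= [M gM]; last move=> p.
  exists (M + `|k|); apply: filterS gM => w gM.
  by rewrite (le_trans (ler_normD _ _))// lerD2r.
by exists M => //; apply: filterS p => w ->; rewrite addrAC.
Qed.

Lemma near_dist_lt c (e : C) : 0 < e -> \forall w \near c, `|w - c| < e.
Proof.
by move=> e0; apply: filterS (nbhsx_ballx c _ e0) => w; rewrite -ball_normE/= distrC.
Qed.

Lemma near_dist_ge c a : c != a -> \forall w \near c, `|c - a| / 2 <= `|w - a|.
Proof.
move=> ca; apply: (@cvg_norm_ge _ _ (nbhs c) _ (fun w => w - a)).
  by rewrite subr_eq0.
by apply: cvgB; [exact: cvg_id | exact: cvg_cst].
Qed.

Lemma near_neq c a : c != a -> \forall w \near c, w != a.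
Proof.
move=> ca; apply: filterS (near_dist_ge ca) => w h; apply/eqP => wa.
have : 0 < `|c - a| / 2 by rewrite divr_gt0// normr_gt0 subr_eq0.
by move=> /lt_le_trans/(_ h); rewrite wa subrr normr0 ltxx.
Qed.

Lemma taylor_div N c a g : c != a ->
  taylor_expandable N c g -> taylor_expandable N c (fun w => g w / (w - a)).
Proof.
move=> ca; have ca0 : c - a != 0 by rewrite subr_eq0.
elim: N g => [|N IHN] g /= [g1 g1N]; last move=> gg1.
  exists (g1 * (`|c - a| / 2)^-1); near=> w.
  have gw : `|g w| <= g1 by near: w.
  have wa : `|c - a| / 2 <= `|w - a| by near: w; exact: near_dist_ge.
  rewrite normrM normfV ler_pM// ?invr_ge0// lef_pV2// posrE.
    by apply: lt_le_trans wa; rewrite divr_gt0// normr_gt0.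
  by rewrite divr_gt0// normr_gt0.
(* Solving for the remainder of [g w / (w - a)] gives [g1] minus a constant, again divided by
   [w - a], so the induction applies to it. *)
exists (fun w => (g1 w + - (g c / (c - a))) / (w - a)).
  by apply: IHN; exact: taylor_addr.
near=> w; have -> : g w = g c + (w - c) * g1 w by near: w.
have : w - a != 0 by rewrite subr_eq0; near: w; exact: near_neq.
by move=> wa; field; rewrite wa ca0.
Unshelve. all: by end_near. Qed.

Lemma taylor_bounded N c g : taylor_expandable N c g -> taylor_expandable 0 c g.
Proof.
elim: N g => [//|N IHN] g [g1 /IHN[M g1M] gg1] /=.
exists (`|g c| + `|M|); near=> w.
have -> : g w = g c + (w - c) * g1 w by near: w.
rewrite (le_trans (ler_normD _ _))// lerD2l normrM -[`|M|]mul1r ler_pM//.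
  by rewrite ltW//; near: w; exact: near_dist_lt.
have g1w : `|g1 w| <= M by near: w.
rewrite (le_trans g1w)// real_ler_norm// ger0_real//.
by rewrite (le_trans (normr_ge0 _) g1w).
Unshelve. all: by end_near. Qed.

Lemma taylor_continuous N c g : taylor_expandable N.+1 c g -> g @ c --> g c.
Proof.
move=> [g1 /taylor_bounded[M g1M] gg1].
apply: cvg_near_eq gg1 _.
rewrite -[X in _ --> X]addr0; apply: cvgD; first exact: cvg_cst.
apply: cvg0_mul_bounded g1M.
by rewrite -(subrr c); apply: cvgB; [exact: cvg_id | exact: cvg_cst].
Qed.

(** Dividing [g w - g c] by [w - c] shifts the coefficients, so the remainder is again the sum of a
    power series at [c]. The base case reads [dd_power_series_le] at a one-node list, where it
    bounds values. *)
Lemma taylor_power_series N (a : nat -> C) c g :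
  (\forall z \near c, series (fun k => a k * (z - c) ^+ k) @ \oo --> g z) ->
  taylor_expandable N c g.
Proof.
elim: N a g => [|N IHN] a g ag.
  have [r [A [r0 rA]]] := dd_power_series_le ag.
  exists (A / r); apply: filterS (near_dist_lt c r0) => w cw.
  rewrite ler_pdivlMr// -[X in _ * X]expr1.
  by apply: (rA [:: w]) => // z; rewrite inE => /eqP ->.
have gc : g c = a 0%N.
  have := nbhs_singleton ag; rewrite -(cvg_shiftS _ (nbhs (g c))) => h.
  apply: cvg_unique h _; first exact: norm_hausdorff.
  apply: (@cvg_near_eq _ _ _ _ _ (fun=> a 0%N)); last exact: cvg_cst.
  apply: nearW => n.
  rewrite /series/= big_nat_recl// expr0 mulr1 big1 ?addr0// => i _.
  by rewrite subrr exprS mul0r mulr0.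
pose g1 w := if w == c then a 1%N else (g w - g c) / (w - c).
exists g1; last first.
  apply: (@nearW _ (nbhs c)) => w; rewrite /g1; have [->|wc] := eqVneq w c.
    by rewrite subrr mul0r addr0.
  by rewrite mulrC divfK ?subr_eq0// addrC subrK.
apply: (IHN (fun k => a k.+1)); apply: filterS ag => w gw; rewrite /g1.
case: eqVneq => [->|wc].
  rewrite -(cvg_shiftS _ (nbhs (a 1%N))).
  apply: (@cvg_near_eq _ _ _ _ _ (fun=> a 1%N)); last exact: cvg_cst.
  apply: nearW => n.
  rewrite /series/= big_nat_recl// expr0 mulr1 big1 ?addr0// => i _.
  by rewrite subrr exprS mul0r mulr0.
have wc0 : w - c != 0 by rewrite subr_eq0.
have : (fun n => (series (fun k => a k * (w - c) ^+ k) n.+1 - g c) / (w - c))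
    @ \oo --> (g w - g c) / (w - c).
  apply: cvgM; last exact: cvg_cst.
  by apply: cvgB; [rewrite cvg_shiftS | exact: cvg_cst].
apply: cvg_near_eq; apply: nearW => n.
rewrite /series/= big_nat_recl// expr0 mulr1 gc [X in X / _]addrAC subrr add0r.
rewrite mulr_suml; apply: eq_bigr => i _.
by rewrite exprSr mulrA mulfK.
Qed.

(** One recursion step of [divdiff_seq], seen as an operator on functions of the first node [w] with
    the second node [a] fixed. *)
Definition dquot g a w : C :=
  if w != a then (g w - g a) / (w - a)
  else lim ((g x - g a) / (x - a) @[x --> a^']).

Lemma dquot_near_eq g g1 a :
  (\forall w \near a, g w = g a + (w - a) * g1 w) -> g1 @ a --> g1 a ->
  (g x - g a) / (x - a) @[x --> a^'] --> g1 a.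
Proof.
move=> gg1 g1a.
apply: (@cvg_near_eq _ _ _ _ _ g1); last exact: cvg_dnbhs.
near=> x.
have -> : g x = g a + (x - a) * g1 x by near: x; apply: cvg_within gg1.
have xa : x - a != 0 by rewrite subr_eq0; near: x; exact: nbhs_dnbhs_neq.
by rewrite addrAC subrr add0r mulrC mulKf.
Unshelve. all: by end_near. Qed.

Lemma dquot_cvg g a : taylor_expandable 2 a g ->
  (g x - g a) / (x - a) @[x --> a^'] --> dquot g a a.
Proof.
move=> [g1 g1T gg1]; rewrite /dquot eqxx.
have g1a := taylor_continuous (N := 0) g1T.
have ga := dquot_near_eq gg1 g1a.
by rewrite (cvg_lim (@norm_hausdorff _ _) ga).
Qed.

(** Away from [a] this is division by a nonvanishing factor. At [a] the quotient coincides with the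
    first Taylor remainder of [g], which costs one order; hence [N.+2] there. *)
Lemma taylor_dquot g a c N : taylor_expandable N.+2 a g ->
  taylor_expandable N.+1 c g -> taylor_expandable N.+1 c (dquot g a).
Proof.
move=> ga gc; have [->|ca] := eqVneq c a; last first.
  apply: (@taylor_near_eq _ _ (fun w => (g w + - g a) / (w - a))).
    by apply: filterS (near_neq ca) => w wa; rewrite /dquot wa.
  by apply: taylor_div => //; exact: taylor_addr.
case: ga => g1 g1N gg1; apply: (@taylor_near_eq N.+1 a g1); last exact: g1N.
have g1a := taylor_continuous g1N.
have ga := cvg_lim (@norm_hausdorff _ _) (dquot_near_eq gg1 g1a).
apply: filterS gg1 => w gw; rewrite /dquot.
case: eqVneq => [->|wa]; first by rewrite ga.
by rewrite gw addrAC subrr add0r mulrC mulKf// subr_eq0.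
Qed.

End TaylorExpandable.

(** * Symmetry and bounds of divided differences with repeated nodes *)

Section AnalyticDividedDifferences.
Context {R : realType}.
Local Notation C := (Cplx R).
Context (Omega : set C) (beta : C -> C).
Hypotheses (Omega_open : open Omega) (beta_analytic : analytic_on Omega beta).
Implicit Types (s : seq C) (g h : C -> C) (a b w : C).

Lemma near_dnbhs_neq w a : \forall x \near w^', x != a.
Proof.
have [->|wa] := eqVneq w a; first exact: nbhs_dnbhs_neq.
by apply: cvg_within; exact: near_neq.
Qed.

Lemma near_dnbhs_open w : Omega w -> \forall x \near w^', Omega x.
Proof. by move=> Ow; apply: cvg_within; exact: open_nbhs_nbhs. Qed.

Lemma eq_dquot g h a w :
  taylor_expandable 2 a g -> taylor_expandable 2 a h ->
  Omega a -> Omega w -> (forall x, Omega x -> g x = h x) ->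
  dquot g a w = dquot h a w.
Proof.
move=> ga ha Oa Ow gh; have [->|wa] := eqVneq w a; last first.
  by rewrite /dquot wa !gh.
apply: cvg_unique (dquot_cvg ga) _; first exact: norm_hausdorff.
apply: cvg_near_eq (dquot_cvg ha); near=> x; rewrite !gh//.
by near: x; exact: near_dnbhs_open.
Unshelve. all: by end_near. Qed.

(** For [w] off [a] and [b] both sides are the same rational expression; both are continuous in [w],
    so the identity extends to coincident nodes. *)
Lemma dquotC g a b w :
  (forall N c, Omega c -> taylor_expandable N.+1 c g) ->
  Omega a -> Omega b -> Omega w ->
  dquot (dquot g b) a w = dquot (dquot g a) b w.
Proof.
move=> gO Oa Ob Ow; have [->//|ab] := eqVneq a b.
have dO c N x : Omega c -> Omega x -> taylor_expandable N.+1 x (dquot g c).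
  by move=> Oc Ox; apply: taylor_dquot; apply: gO.
have ddO c d x : Omega c -> Omega d -> Omega x ->
    taylor_expandable 1 x (dquot (dquot g c) d).
  by move=> Oc Od Ox; apply: taylor_dquot; apply: dO.
have h1 := cvg_dnbhs (taylor_continuous (ddO b a w Ob Oa Ow)).
have h2 := cvg_dnbhs (taylor_continuous (ddO a b w Oa Ob Ow)).
apply: cvg_unique h1 _; first exact: norm_hausdorff.
apply: cvg_near_eq h2; near=> x.
have xa : x != a by near: x; exact: near_dnbhs_neq.
have xb : x != b by near: x; exact: near_dnbhs_neq.
rewrite /dquot xa xb ab (eq_sym b) ab.
have xa0 : x - a != 0 by rewrite subr_eq0.
have xb0 : x - b != 0 by rewrite subr_eq0.
have ab0 : a - b != 0 by rewrite subr_eq0.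
have ba0 : b - a != 0 by rewrite subr_eq0 eq_sym.
by field; rewrite xa0 xb0 ab0 ba0.
Unshelve. all: by end_near. Qed.

Lemma divdiff_seq_cons a b s :
  divdiff_seq beta a (b :: s) = dquot (divdiff_seq beta ^~ s) b a.
Proof. by []. Qed.

(** All orders are treated at once, since each further node consumes one order of expansion at that
    node. *)
Lemma divdiff_taylor s N c : {in s, forall z, Omega z} -> Omega c ->
  taylor_expandable N.+1 c (divdiff_seq beta ^~ s).
Proof.
elim: s N c => [|a s IHs] N c sO Oc.
  have [u uc] := beta_analytic Oc; exact: taylor_power_series uc.
have sO' : {in s, forall z, Omega z}.
  by move=> z zs; apply: sO; rewrite inE zs orbT.
have Oa : Omega a by apply: sO; rewrite mem_head.
exact: taylor_dquot (IHs _ _ sO' Oa) (IHs _ _ sO' Oc).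
Qed.

(** Cleared of its denominator, the recurrence survives at coincident nodes, where both sides
    vanish. *)
Lemma dd_recM z0 z1 s : (z0 - z1) * dd beta [:: z0, z1 & s] =
  dd beta (z0 :: s) - dd beta (z1 :: s).
Proof.
have [->|z01] := eqVneq z0 z1; first by rewrite !subrr mul0r.
by rewrite dd_rec// mulrC divfK// subr_eq0.
Qed.

Lemma dd_continuous s a : {in s, forall z, Omega z} -> Omega a ->
  dd beta (w :: s) @[w --> a] --> dd beta (a :: s).
Proof. by move=> sO Oa; apply: (taylor_continuous (divdiff_taylor 0 sO Oa)). Qed.

(** The first node stays in place; [dquotC] exchanges two neighbouring nodes behind it, and
    [move_front] carries a chosen node forward by such exchanges. *)
Lemma divdiff_seq_perm s t w : perm_eq s t -> {in s, forall z, Omega z} ->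
  Omega w -> divdiff_seq beta w s = divdiff_seq beta w t.
Proof.
have move_front x s1 s2 y : {in x :: s1 ++ s2, forall z, Omega z} -> Omega y ->
    divdiff_seq beta y (s1 ++ x :: s2) = divdiff_seq beta y (x :: s1 ++ s2).
  elim: s1 y => [//|u s1 IHs1] y sO Oy.
  have [Ox Ou] : Omega x /\ Omega u.
    by split; apply: sO; rewrite !inE eqxx ?orbT.
  have s12O : {in s1 ++ s2, forall z, Omega z}.
    by move=> z zs; apply: sO; rewrite !inE zs !orbT.
  have xs12O : {in x :: s1 ++ s2, forall z, Omega z}.
    by move=> z; rewrite inE => /predU1P[->//|]; exact: s12O.
  have s1xs2O : {in s1 ++ x :: s2, forall z, Omega z}.
    by move=> z zs; apply: xs12O; rewrite -(perm_mem (permEl (perm_catCA s1 [:: x] s2))).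
  rewrite cat_cons divdiff_seq_cons.
  rewrite (eq_dquot (divdiff_taylor 1 s1xs2O Ou) (divdiff_taylor 1 xs12O Ou) Ou Oy).
    apply: (@dquotC (divdiff_seq beta ^~ (s1 ++ s2)) _ _ _ _ Ou Ox Oy) => N c Oc.
    exact: divdiff_taylor.
  by move=> z Oz; exact: IHs1.
elim: s t w => [|a s IHs] t w.
  by rewrite perm_sym => /perm_nilP ->.
move=> st sO Ow; have := perm_mem st a; rewrite mem_head => /esym/path.splitPr ta.
move: st; case: ta => t1 t2 st.
have sO' : {in s, forall z, Omega z}.
  by move=> z zs; apply: sO; rewrite inE zs orbT.
have st' : perm_eq s (t1 ++ t2).
  by rewrite -(perm_cons a) (perm_trans st)// perm_catC/= perm_cons perm_catC.
have tO : {in t1 ++ t2, forall z, Omega z}.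
  by move=> z; rewrite -(perm_mem st'); exact: sO'.
have Oa : Omega a by apply: sO; rewrite mem_head.
rewrite move_front; last by [].
  apply: eq_dquot (divdiff_taylor 1 sO' Oa) (divdiff_taylor 1 tO Oa) Oa Ow _.
  by move=> x Ox; exact: IHs.
by move=> z; rewrite inE => /predU1P[->//|]; exact: tO.
Qed.

(** Only the exchange of two distinct leading nodes is left after [divdiff_seq_perm], and there the
    difference quotient is visibly symmetric. *)
Lemma dd_perm s t : perm_eq s t -> {in s, forall z, Omega z} ->
  dd beta s = dd beta t.
Proof.
case: s => [|a s]; first by rewrite perm_sym => /perm_nilP ->.
case: t => [|b t]; first by move=> /perm_nilP.
move=> st sO; have sO' : {in s, forall z, Omega z}.
  by move=> z zs; apply: sO; rewrite inE zs orbT.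
have Oa : Omega a by apply: sO; rewrite mem_head.
have [ab|ab] := eqVneq a b.
  by rewrite -{}ab in st *; rewrite perm_cons in st; exact: divdiff_seq_perm.
have bs : b \in s.
  have := perm_mem st b; rewrite mem_head inE => /orP[]//.
  by rewrite eq_sym (negPf ab).
have as' := perm_to_rem bs.
have bt : perm_eq t (a :: rem b s).
  rewrite -(perm_cons b) perm_sym -(permPr st).
  rewrite (perm_trans _ (_ : perm_eq (a :: b :: rem b s) _))//.
    by rewrite (permEl (perm_catCA [:: b] [:: a] (rem b s))).
  by rewrite perm_cons perm_sym.
have tO : {in t, forall z, Omega z}.
  by move=> z zt; apply: sO; rewrite (perm_mem st) inE zt orbT.
have Ob : Omega b by exact: sO'.
have -> : dd beta (a :: s) = dd beta [:: a, b & rem b s].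
  exact: divdiff_seq_perm.
have -> : dd beta (b :: t) = dd beta [:: b, a & rem b s].
  exact: divdiff_seq_perm.
have ba : b != a by rewrite eq_sym.
rewrite (dd_rec _ _ ab) (dd_rec _ _ ba).
by rewrite -[b - a]opprB invrN mulrN -mulNr opprB.
Qed.

Lemma near_all_mem (I : eqType) (T : Type) (F : set_system T) {FF : Filter F}
    (s : seq I) (P : I -> T -> Prop) :
  {in s, forall i, \forall t \near F, P i t} ->
  \forall t \near F, {in s, forall i, P i t}.
Proof.
elim: s => [|i s IHs] sP; first exact: nearW.
have := IHs (fun j js => sP j (mem_behead (s := i :: s) js)).
apply: filterS2 (sP i (mem_head _ _)) => t Pi Ps j.
by rewrite inE => /predU1P[->//|]; exact: Ps.
Qed.

(* Distinct nodes are handled by the partial sums of the power series at c;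
   repeated nodes are then reached by moving one node at a time. *)
Lemma dd_cluster_bounded c : Omega c ->
  exists2 U : set C, nbhs c U & forall n, exists M, forall s, size s = n ->
    {in s, forall z, U z} -> `|dd beta s| <= M.
Proof.
move=> Oc; have [u uc] := beta_analytic Oc.
have [r [A [r0 rA]]] := dd_power_series_le uc.
have Uo : open (ball c r `&` Omega) by apply: openI => //; exact: ball_open.
exists (ball c r `&` Omega).
  by apply: open_nbhs_nbhs; split=> //; split => //; exact: ballxx.
move=> n; exists (A / r ^+ n) => s sn sU.
suff : forall s1 s2, uniq s2 -> size (s1 ++ s2) = n ->
    {in s1 ++ s2, forall z, (ball c r `&` Omega) z} ->
    `|dd beta (s1 ++ s2)| <= A / r ^+ n.
  by move=> /(_ s [::]); rewrite cats0; apply.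
move=> {s sn sU} s1; elim: s1 => [|a s1 IHs1] s2 us2 sn sU.
  rewrite ler_pdivlMr ?exprn_gt0// -sn; apply: rA => // z /sU[+ _].
  by rewrite -ball_normE/= distrC.
have Ua := sU a (mem_head _ _).
have s12O : {in s1 ++ s2, forall z, Omega z}.
  by move=> z zs; have [] := sU z (mem_behead (s := a :: s1 ++ s2) zs).
apply: norm_cvg_le (cvg_dnbhs (dd_continuous s12O (proj2 Ua))).
have : \forall w \near a^', {in s2, forall z, w != z}.
  by apply: near_all_mem => z _; exact: near_dnbhs_neq.
move=> ws2; near=> w.
have Uw : (ball c r `&` Omega) w.
  by near: w; apply: cvg_within; exact: open_nbhs_nbhs.
have ws : {in s2, forall z, w != z} by near: w.
have sU' : {in s1 ++ w :: s2, forall z, (ball c r `&` Omega) z}.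
  move=> z; rewrite mem_cat inE orbCA -mem_cat => /predU1P[->//|zs].
  by apply: sU; rewrite inE zs orbT.
rewrite (@dd_perm (w :: s1 ++ s2) (s1 ++ w :: s2)).
- apply: IHs1 => //.
    by rewrite /= us2 andbT; apply/negP => /ws; rewrite eqxx.
  by rewrite -sn !size_cat/= addnS.
- by rewrite (permEl (perm_catCA [:: w] s1 s2)).
- move=> z zs; apply: (proj2 (sU' z _)).
  by rewrite -(perm_mem (permEl (perm_catCA [:: w] s1 s2))).
Unshelve. all: by end_near. Qed.

(** * Joint continuity in all nodes *)

Section JointContinuity.
Context {T : Type} {F : set_system T} {FF : Filter F}.
Context {I : eqType} (f : T -> I -> C) (c : I -> C).
Implicit Types l : seq I.

Lemma near_map_open l : {in l, forall i, Omega (c i)} ->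
  {in l, forall i, f t i @[t --> F] --> c i} ->
  \forall t \near F, {in [seq f t i | i <- l], forall z, Omega z}.
Proof.
move=> lO lf; have : \forall t \near F, {in l, forall i, Omega (f t i)}.
  apply: near_all_mem => i il; apply: (lf i il Omega).
  by apply: open_nbhs_nbhs; split => //; exact: lO.
by apply: filterS => t tO z /mapP[i /tO Oi ->].
Qed.

(* If two limit nodes differ, dd_rec reduces to fewer nodes with a denominator
   bounded away from 0; otherwise all nodes cluster at one point. *)
Lemma dd_locally_bounded l : {in l, forall i, Omega (c i)} ->
  {in l, forall i, f t i @[t --> F] --> c i} ->
  exists M, \forall t \near F, `|dd beta [seq f t i | i <- l]| <= M.
Proof.
have [n] := ubnP (size l); elim: n l => // n IHn [|i l].
  by exists 0; apply: nearW => t; rewrite /= normr0.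
rewrite ltnS => ln lO lf.
have [/hasP[j jl cij]|/hasPn lc] := boolP (has (fun j => c j != c i) l).
  pose l' := rem j l; have ll' : perm_eq l (j :: l') by exact: perm_to_rem.
  have sub : {subset i :: j :: l' <= i :: l}.
    by move=> k; rewrite !inE (perm_mem ll') inE.
  have sub1 : {subset i :: l' <= i :: l}.
    by move=> k ki; apply: sub; move: ki; rewrite !inE => /orP[]->; rewrite ?orbT.
  have sub2 : {subset j :: l' <= i :: l}.
    by move=> k ki; apply: sub; rewrite inE ki orbT.
  have sl' : ((size l').+1 < n)%N by rewrite (leq_trans _ ln)//= (perm_size ll').
  have [M1 h1] := IHn (i :: l') sl' (sub_in1 sub1 lO) (sub_in1 sub1 lf).
  have [M2 h2] := IHn (j :: l') sl' (sub_in1 sub2 lO) (sub_in1 sub2 lf).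
  have cij0 : c i - c j != 0 by rewrite subr_eq0 eq_sym.
  have fij : (fun t => f t i - f t j) @ F --> c i - c j.
    by apply: cvgB; apply: lf; rewrite !inE ?eqxx ?jl ?orbT.
  have fij_ge : \forall t \near F, `|c i - c j| / 2 <= `|f t i - f t j|.
    exact: cvg_norm_ge fij.
  have hO := near_map_open lO lf.
  exists ((M1 + M2) / (`|c i - c j| / 2)); near=> t.
  have tO : {in [seq f t k | k <- i :: l], forall z, Omega z} by near: t.
  rewrite (@dd_perm _ [seq f t k | k <- [:: i, j & l']])//; last first.
    by apply: perm_map; rewrite perm_cons.
  have g1 : `|dd beta [seq f t k | k <- i :: l']| <= M1 by near: t.
  have g2 : `|dd beta [seq f t k | k <- j :: l']| <= M2 by near: t.
  have g3 : `|c i - c j| / 2 <= `|f t i - f t j| by near: t.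
  have d0 : 0 < `|c i - c j| / 2 by rewrite divr_gt0// normr_gt0.
  have fij0 : f t i != f t j.
    by rewrite -subr_eq0 -normr_gt0; exact: lt_le_trans g3.
  rewrite !map_cons dd_rec// normrM normfV ler_pM ?invr_ge0//.
    by rewrite (le_trans (ler_normB _ _))// lerD.
  by rewrite lef_pV2// posrE// (lt_le_trans d0).
have [U Uc UM] := dd_cluster_bounded (lO i (mem_head _ _)).
have [M MU] := UM (size l).+1; exists M.
have : \forall t \near F, {in i :: l, forall k, U (f t k)}.
  apply: near_all_mem => k kl; apply: (lf k kl U).
  by move: kl; rewrite inE => /predU1P[->//|/lc]; rewrite negbK => /eqP ->.
apply: filterS => t tU; apply: MU; first by rewrite /= size_map.
by move=> z /(mapP (s := i :: l))[k /tU Uk ->].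
Unshelve. all: by end_near. Qed.

End JointContinuity.

(** Nodes are replaced by their limits one at a time. By [dd_recM] each replacement costs a
    displacement tending to 0 times a divided difference with one node more, which is locally
    bounded. *)
Lemma dd_joint_continuous (T : Type) (F : set_system T) {FF : Filter F}
    (I : eqType) (f : T -> I -> C) (c : I -> C) (l : seq I) :
  {in l, forall i, Omega (c i)} ->
  {in l, forall i, f t i @[t --> F] --> c i} ->
  dd beta [seq f t i | i <- l] @[t --> F] --> dd beta [seq c i | i <- l].
Proof.
(* The flag tells a moving node from one frozen at its limit, so that mixed lists are again
   convergent families of nodes. *)
move=> lO lf; pose g t (k : bool * I) := if k.1 then f t k.2 else c k.2.
pose w (b : bool) := map (fun i : I => (b, i)).
have gO (l' : seq (bool * I)) : {in l', forall k, k.2 \in l} ->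
    {in l', forall k, Omega (c k.2)}.
  by move=> h k /h; exact: lO.
have gf (l' : seq (bool * I)) : {in l', forall k : bool * I, k.2 \in l} ->
    {in l', forall k, g t k @[t --> F] --> c k.2}.
  by move=> h [[] i] /h; [exact: lf | move=> _; exact: cvg_cst].
have wl (b : bool) (l' : seq I) : {subset l' <= l} ->
    {in w b l', forall k, k.2 \in l}.
  by move=> h k /mapP[i /h il ->].
have catl (l1 l2 : seq (bool * I)) : {in l1, forall k, k.2 \in l} ->
    {in l2, forall k, k.2 \in l} -> {in l1 ++ l2, forall k, k.2 \in l}.
  by move=> h1 h2 k; rewrite mem_cat => /orP[/h1|/h2].
(* [l1] holds nodes that move in both lists; it must be general, as the induction on [l2] appends to
   it the node whose turn comes later. *)
suff : forall l1 l2 : seq I, {subset l1 <= l} -> {subset l2 <= l} ->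
    dd beta [seq g t k | k <- w true l1 ++ w true l2] -
    dd beta [seq g t k | k <- w true l1 ++ w false l2] @[t --> F] --> 0.
  move=> /(_ [::] l) /= h; rewrite -[X in _ --> X]add0r.
  have : (fun t => dd beta [seq g t k | k <- w true l] -
      dd beta [seq g t k | k <- w false l] + dd beta [seq c i | i <- l]) @ F -->
      0 + dd beta [seq c i | i <- l].
    by apply: cvgD; [exact: h | exact: cvg_cst].
  by under eq_fun do rewrite -!map_comp subrK.
move=> l1 l2; elim: l2 l1 => [|i l2 IHl2] l1 l1l l2l.
  by under eq_fun do rewrite subrr; exact: cvg_cst.
have il : i \in l by apply: l2l; rewrite mem_head.
have l2l' : {subset l2 <= l} by move=> j jl; apply: l2l; rewrite inE jl orbT.
have l1l' : {subset rcons l1 i <= l}.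
  by move=> j; rewrite mem_rcons inE => /predU1P[->//|]; exact: l1l.
(* Node [i] occurs twice, moving and frozen: this is the longer list that [dd_recM] produces when
   [i] is frozen. *)
pose m := [:: (true, i), (false, i) & w true l1 ++ w false l2].
have ml : {in m, forall k, k.2 \in l}.
  move=> k; rewrite !inE => /or3P[/eqP->//|/eqP->//|].
  by apply: catl => //; exact: wl.
have [M mM] := dd_locally_bounded (FF := FF) (gO _ ml) (gf _ ml).
have mO := near_map_open (FF := FF) (gO _ ml) (gf _ ml).
have fi : (fun t => f t i - c i) @ F --> 0.
  by rewrite -(subrr (c i)); apply: cvgB; [exact: lf | exact: cvg_cst].
rewrite -[X in _ --> X]addr0.
apply: cvg_near_eq (cvgD (IHl2 (rcons l1 i) l1l' l2l') (cvg0_mul_bounded fi mM)).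
near=> t.
have tO : {in [seq g t k | k <- m], forall z, Omega z} by near: t.
have front (b : bool) : dd beta [seq g t k | k <- w true l1 ++ (b, i) :: w false l2] =
    dd beta [seq g t k | k <- (b, i) :: w true l1 ++ w false l2].
  apply: dd_perm => [|z].
    by apply: perm_map; rewrite (permEl (perm_catCA (w true l1) [:: (b, i)] _)).
  move=> /mapP[k kl ->]; apply: tO; apply: map_f.
  move: kl; rewrite mem_cat inE orbCA -mem_cat !inE.
  by case: b; case/orP=> ->; rewrite ?orbT.
pose W (b1 b2 : bool) := dd beta [seq g t k | k <- w true l1 ++ (b1, i) :: w b2 l2].
have key : (f t i - c i) * dd beta [seq g t k | k <- m] =
    W true false - W false false.
  by rewrite /W !front; exact: dd_recM.
have Wr (b : bool) : dd beta [seq g t k | k <- w true (rcons l1 i) ++ w b l2] =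
    W true b.
  by rewrite /W /w map_rcons cat_rcons.
transitivity (W true true - W true false + (W true false - W false false)).
  by rewrite addrA subrK.
by rewrite -key -!Wr.
Unshelve. all: by end_near. Qed.

(** * Derivatives of divided differences with respect to their nodes *)

Lemma cvg_addl_dnbhs0 a : t + a @[t --> (0 : C)^'] --> a.
Proof.
apply: cvg_dnbhs; have := @cvgD C C C (nbhs (0 : C)) _ id (fun=> a) 0 a.
by rewrite add0r; apply; [exact: cvg_id | exact: cvg_cst].
Qed.

(** The [q.+1] copies of [a] are moved to [t + a] one by one. Each move contributes [t] times a
    divided difference with one node more, and all these tend to the same limit, whence the factor
    [q.+1]. *)
Lemma dd_nseq_derive (q : nat) s a : {in s, forall z, Omega z} -> Omega a ->
  t^-1 * (dd beta (nseq q.+1 (t + a) ++ s) - dd beta (nseq q.+1 a ++ s))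
    @[t --> (0 : C)^'] --> q.+1%:R * dd beta (nseq q.+2 a ++ s).
Proof.
move=> sO Oa; pose m (j : nat) (t : C) := nseq j.+1 (t + a) ++ nseq (q - j).+1 a ++ s.
have ta := @cvg_addl_dnbhs0 a.
have -> : q.+1%:R * dd beta (nseq q.+2 a ++ s) =
    \sum_(j < q.+1) dd beta (nseq q.+2 a ++ s).
  by rewrite sumr_const card_ord mulr_natl.
have mq (j : 'I_q.+1) : dd beta (m j t) @[t --> (0 : C)^'] --> dd beta (nseq q.+2 a ++ s).
  (* Labels for the nodes: [inl true] for copies already moved, [inl false] for copies still at [a],
     [inr] for the fixed nodes of [s]. *)
  pose f (t : C) (i : bool + C) := match i with
    | inl b => if b then t + a else a | inr z => z end.
  pose c (i : bool + C) := match i with inl b => a | inr z => z end.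
  pose l : seq (bool + C) :=
    nseq j.+1 (inl true) ++ nseq (q - j).+1 (inl false) ++ map inr s.
  have mapinr (h : bool + C -> C) : (forall z, h (inr z) = z) ->
      [seq h i | i <- [seq inr z | z <- s]] = s.
    by move=> hinr; rewrite -map_comp map_id_in// => z _ /=.
  have -> : nseq q.+2 a ++ s = [seq c i | i <- l].
    rewrite !map_cat !map_nseq mapinr// catA -nseqD.
    by rewrite addSn addnS subnKC// -ltnS.
  have -> : (fun t => dd beta (m j t)) = (fun t => dd beta [seq f t i | i <- l]).
    by apply: funext => t; rewrite !map_cat !map_nseq mapinr.
  apply: dd_joint_continuous => i.
    rewrite !mem_cat => /or3P[/nseqP[->]//|/nseqP[->]//|/mapP[z zs ->]].
    exact: sO.
  by case: i => [[]|z] _; [exact: ta | exact: cvg_cst | exact: cvg_cst].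
apply: cvg_near_eq (@cvg_sumr C C 'I_q.+1 (0 : C)^' _ (index_enum 'I_q.+1)
  (fun t j => dd beta (m j t)) _ mq).
near=> t.
have t0 : t != 0 by near: t; exact: near_dnbhs_neq.
have Ot : Omega (t + a).
  by near: t; apply: (ta Omega); exact: open_nbhs_nbhs.
pose E (j : nat) := dd beta (nseq j (t + a) ++ nseq (q.+1 - j) a ++ s).
have Em (j : nat) : (j < q.+1)%N -> E j.+1 - E j = t * dd beta (m j t).
  move=> jq; pose u := nseq j (t + a) ++ nseq (q - j) a ++ s.
  have -> : m j t = (t + a) :: nseq j (t + a) ++ [:: a] ++ nseq (q - j) a ++ s by [].
  have uO : {in [:: t + a, a & u], forall z, Omega z}.
    move=> z; rewrite !inE !mem_cat.
    by case/or3P=> [/eqP->|/eqP->|/or3P[/nseqP[->]|/nseqP[->]|/sO]].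
  rewrite (@dd_perm _ [:: t + a, a & u]); last 2 first.
  - by rewrite perm_cons (permEl (perm_catCA (nseq j (t + a)) [:: a] _)).
  - move=> z; rewrite !inE !mem_cat inE => zs; apply: uO; move: zs.
    by rewrite !inE !mem_cat; case/or4P=> [->|->|->|/orP[]->]; rewrite ?orbT.
  transitivity ((t + a - a) * dd beta [:: t + a, a & u]); last by rewrite addrK.
  rewrite dd_recM; congr (_ - _).
  rewrite /E (subSn (ltnSE jq)); apply: dd_perm.
    by rewrite (permEl (perm_catCA (nseq j (t + a)) [:: a] (nseq (q - j) a ++ s))).
  move=> z; rewrite mem_cat inE mem_cat => zs; apply: uO; move: zs.
  by rewrite !inE !mem_cat; case/or4P=> ->; rewrite ?orbT.
have -> : dd beta (nseq q.+1 (t + a) ++ s) = E q.+1 by rewrite /E subnn.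
have -> : dd beta (nseq q.+1 a ++ s) = E 0%N by rewrite /E subn0.
rewrite -(telescope_sumr E (leq0n q.+1)) mulr_sumr big_mkord.
by apply: eq_bigr => j _; rewrite Em// mulKf.
Unshelve. all: by end_near. Qed.

Section MixedDerivatives.
Context {d : nat}.
Implicit Types (r q : 'I_d.+1 -> nat) (z : 'rV[C]_d.+1).

(** Each coordinate occurs once on its own account and once more for every derivative taken in
    it. *)
Definition node_seq r z : seq C :=
  flatten [seq nseq (r p).+1 (z 0 p) | p <- enum 'I_d.+1].

Lemma node_seq_open r z : (forall p, Omega (z 0 p)) ->
  {in node_seq r z, forall x, Omega x}.
Proof. by move=> zO x /flatten_mapP[p _ /nseqP[-> _]]. Qed.

Lemma perm_node_seq r z p : perm_eq (node_seq r z)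
  (nseq (r p).+1 (z 0 p) ++
   flatten [seq nseq (r i).+1 (z 0 i) | i <- rem p (enum 'I_d.+1)]).
Proof.
rewrite -[X in perm_eq _ X]/(flatten
  [seq nseq (r i).+1 (z 0 i) | i <- p :: rem p (enum 'I_d.+1)]).
by apply: perm_flatten; apply: perm_map; apply: perm_to_rem; rewrite mem_enum.
Qed.

(** By symmetry the copies of coordinate [p] come to the front, where [dd_nseq_derive] applies; its
    factor [(r p).+1] raises the factorial of [r p]. As [Omega] is open, knowing [h] on tuples of
    [Omega] is enough. *)
Lemma partial_derive_dd (h : 'rV[C]_d.+1 -> C) r p :
  (forall z, (forall i, Omega (z 0 i)) ->
    h z = (\prod_i (r i)`!)%:R * dd beta (node_seq r z)) ->
  forall z, (forall i, Omega (z 0 i)) ->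
    partial_derive p h z = (\prod_i (r i + (i == p))`!)%:R *
      dd beta (node_seq (fun i => r i + (i == p))%N z).
Proof.
move=> hE z zO.
pose s := flatten [seq nseq (r i).+1 (z 0 i) | i <- rem p (enum 'I_d.+1)].
have neq i : i \in rem p (enum 'I_d.+1) -> i != p.
  by rewrite (mem_rem_uniq _ (enum_uniq _)) inE => /andP[].
have sO : {in s, forall x, Omega x}.
  by move=> x /flatten_mapP[i _ /nseqP[-> _]].
have -> : dd beta (node_seq (fun i => r i + (i == p))%N z) =
    dd beta (nseq (r p).+2 (z 0 p) ++ s).
  rewrite (dd_perm (perm_node_seq _ _ p) (node_seq_open zO)).
  rewrite eqxx addn1; congr (dd beta (_ ++ flatten _)).
  by apply/eq_in_map => i /neq /negPf ->; rewrite addn0.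
have -> : (\prod_i (r i + (i == p))`! = (\prod_i (r i)`!) * (r p).+1)%N.
  rewrite (bigD1 p)//= [in RHS](bigD1 p)//= eqxx addn1 factS -mulnA mulnC.
  by congr (_ * _ * _)%N; apply: eq_bigr => i /negPf ->; rewrite addn0.
rewrite natrM -mulrA /partial_derive /derive.
apply: cvg_lim; first exact: norm_hausdorff.
have tO : \forall t \near (0 : C)^', Omega (t + z 0 p).
  apply: (@cvg_addl_dnbhs0 (z 0 p) Omega); exact: open_nbhs_nbhs.
have lim_s : (\prod_i (r i)`!)%:R *
      (t^-1 * (dd beta (nseq (r p).+1 (t + z 0 p) ++ s) -
               dd beta (nseq (r p).+1 (z 0 p) ++ s))) @[t --> (0 : C)^'] -->
    (\prod_i (r i)`!)%:R * ((r p).+1%:R * dd beta (nseq (r p).+2 (z 0 p) ++ s)).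
  by apply: cvgM; [exact: cvg_cst | exact: dd_nseq_derive].
apply: cvg_near_eq lim_s; near=> t.
have zt i : (t *: delta_mx 0 p + z : 'rV[C]_d.+1) 0 i = t * (i == p)%:R + z 0 i.
  by rewrite !mxE eqxx.
have ztO i : Omega ((t *: delta_mx 0 p + z : 'rV[C]_d.+1) 0 i).
  rewrite zt; have [->|ip] := eqVneq i p; last by rewrite mulr0 add0r.
  by rewrite mulr1; near: t.
rewrite /= /shift /= !hE// -mulrBr /GRing.scale/= mulrCA; congr (_ * (_ * (_ - _))).
  rewrite (dd_perm (perm_node_seq _ _ p) (node_seq_open ztO)) zt eqxx mulr1.
  congr (dd beta (_ ++ flatten _)).
  by apply/eq_in_map => i /neq /negPf ip; rewrite zt ip mulr0 add0r.
by rewrite (dd_perm (perm_node_seq _ _ p) (node_seq_open zO)).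
Unshelve. all: by end_near. Qed.

Lemma mixed_derive_divdiff q z : (forall i, Omega (z 0 i)) ->
  mixed_derive q (divdiff beta) z =
    (\prod_i (q i)`!)%:R * dd beta (node_seq q z).
Proof.
pose E r z := (\prod_i (r i)`!)%:R * dd beta (node_seq r z).
pose onO (h g : 'rV[C]_d.+1 -> C) :=
  forall z, (forall i, Omega (z 0 i)) -> h z = g z.
have iter_derive p k r (h : 'rV[C]_d.+1 -> C) : onO h (E r) ->
    onO (iter k (partial_derive p) h) (E (fun i => r i + k * (i == p))%N).
  move=> hE; elim: k => [|k IHk] y yO.
    rewrite [LHS]hE//; congr (E _ y); apply: funext => i.
    by rewrite mul0n addn0.
  rewrite [LHS](partial_derive_dd p IHk yO); congr (E _ y); apply: funext => i.
  by rewrite mulSn addnA addnAC.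
(* The multiplicities accumulate along the list of variables; over the full enumeration the sum
   reduces to [q i]. *)
have foldE (l : seq 'I_d.+1) :
    onO (foldr (fun p u => iter (q p) (partial_derive p) u) (divdiff beta) l)
      (E (fun i => \sum_(p <- l) q p * (i == p))%N).
  elim: l => [|p l IHl] y yO.
    rewrite /E big1 => [|i _]; last by rewrite big_nil.
    rewrite mul1r /divdiff -[LHS]/(dd beta (y 0 ord0 :: _)); congr (dd beta _).
    rewrite /node_seq enum_ordSl [map _ (_ :: _)]/= big_nil /=; congr (_ :: _).
    rewrite -map_comp; elim: (enum 'I_d) => //= i e ->.
    by rewrite big_nil.
  rewrite [LHS](iter_derive _ _ _ _ IHl y yO); congr (E _ y).
  by apply: funext => i; rewrite big_cons addnC.
move=> zO; rewrite [LHS](foldE _ _ zO) -[RHS]/(E q z); congr (E _ z).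
apply: funext => i; rewrite big_enum/= (bigD1 i)//= eqxx muln1 big1 ?addn0// => p.
by rewrite eq_sym => /negPf ->; rewrite muln0.
Qed.

End MixedDerivatives.

End AnalyticDividedDifferences.

(** * Newton's form of sums over Jordan blocks *)

Lemma Tagged_inj (I : eqType) (T : I -> eqType) i : injective (@Tagged I i T).
Proof. by move=> x y /eqP; rewrite eq_Tagged => /eqP. Qed.

Lemma inj_surj_bij (S T : finType) (h : S -> T) :
  injective h -> (forall y, exists x, h x = y) -> bijective h.
Proof.
move=> hI /fin_all_exists[g hg]; exists g => // x.
by apply: hI; rewrite hg.
Qed.

(** * Reindexing of sums over dependent functions *)

Section DependentSums.
Context {V : nmodType}.

(** Used twice to merge the nested sums of [gmoi] over eigenvalues, blocks and powers into one sum
    over tuples of [jordan_index]. *)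
Lemma sum_dffun_tagged (I : finType) (A : I -> finType)
    (B : forall i, A i -> finType)
    (H : {dffun forall i, {x : A i & B i x}} -> V) :
  \sum_f H f = \sum_(k : {dffun forall i, A i})
    \sum_(b : {dffun forall i, B i (k i)})
      H (finfun (fun i => Tagged (B i) (b i))).
Proof.
rewrite sig_big_dep /=.
pose h (p : {k : {dffun forall i, A i} & {dffun forall i, B i (k i)}}) :
  {dffun forall i, {x : A i & B i x}} :=
  finfun (fun i => Tagged (B i) (tagged p i)).
rewrite (reindex h) /=; first by apply: eq_bigr => -[].
apply: onW_bij; apply: inj_surj_bij => [[k b] [k' b']|f].
  move=> /ffunP hh.
  have {}hh i : Tagged (B i) (b i) = Tagged (B i) (b' i).
    by have := hh i; rewrite !ffunE.
  have kk' : k = k' by apply/ffunP => i; exact: (congr1 tag (hh i)).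
  move: b' hh; rewrite -kk' => b' hh; congr (Tagged _ _).
  by apply/ffunP => i; exact: Tagged_inj (hh i).
have [k kf] : exists k : {dffun forall i, A i}, forall i, k i = tag (f i).
  by exists (finfun (fun i => tag (f i))) => i; rewrite ffunE.
have [b fb] : exists b : forall i, B i (k i), forall i, f i = Tagged (B i) (b i).
  apply: (@fin_all_exists I (fun i => B i (k i))
    (fun i b => f i = Tagged (B i) b)) => i.
  by rewrite kf; exists (tagged (f i)); case: (f i).
exists (Tagged (fun k : {dffun forall i, A i} => {dffun forall i, B i (k i)})
  (finfun b)).
apply/ffunP => i; rewrite [RHS]fb /h ffunE /=; congr (Tagged _ _).
exact: ffunE.
Qed.

Lemma sum_dffun_ord0 (T : 'I_0 -> finType) (H : {dffun forall p, T p} -> V) v :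
  (forall f, H f = v) -> \sum_f H f = v.
Proof.
move=> Hv; rewrite (eq_bigr (fun=> v)) // sumr_const card_dep_ffun.
have -> // : [seq #|T x| | x : 'I_0] = [::].
by apply: size0nil; rewrite size_image card_ord.
Qed.

Lemma sum_dffun_ordS d (T : 'I_d.+1 -> finType)
    (H : T ord0 -> {dffun forall p : 'I_d, T (lift ord0 p)} -> V) :
  \sum_(f : {dffun forall p, T p}) H (f ord0) (finfun (fun p => f (lift ord0 p))) =
  \sum_a \sum_g H a g.
Proof.
rewrite pair_bigA.
pose h (f : {dffun forall p, T p}) :
   T ord0 * {dffun forall p : 'I_d, T (lift ord0 p)} :=
  (f ord0, finfun (fun p => f (lift ord0 p))).
rewrite [RHS](reindex h)//; apply: onW_bij; apply: inj_surj_bij.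
  move=> f f' [f0 /ffunP fS]; apply/ffunP => p.
  case: (unliftP ord0 p) => [j ->|-> //].
  by have := fS j; rewrite !ffunE.
move=> [a g].
(* Comparing tagged values relates elements of [T p] and [T ord0] without a cast along
   [p = ord0]. *)
have [f fP] : exists f : forall p, T p, forall p,
    (p = ord0 -> Tagged T (f p) = Tagged T a) /\
    (forall j, p = lift ord0 j -> Tagged T (f p) = Tagged T (g j)).
  apply: (@fin_all_exists _ T (fun p x =>
    (p = ord0 -> Tagged T x = Tagged T a) /\
    (forall j, p = lift ord0 j -> Tagged T x = Tagged T (g j)))) => p.
  case: (unliftP ord0 p) => [j ->|->].
    exists (g j); split=> [/esym/eqP|i /lift_inj -> //].
    by rewrite (negPf (neq_lift _ _)).
  by exists a; split=> // j /eqP; rewrite (negPf (neq_lift _ _)).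
exists (finfun f); rewrite /h; congr (_, _).
  by rewrite ffunE; apply: (@Tagged_inj _ T); exact: (fP ord0).1.
apply/ffunP => j; rewrite !ffunE; apply: (@Tagged_inj _ T).
exact: (fP (lift ord0 j)).2.
Qed.

End DependentSums.

Definition newton_mat (K : comNzRingType) n (A : 'M[K]_n) (mu : nat -> K) j :
  'M[K]_n := \prod_(t < j) (A - (mu t)%:M).

Lemma newton_mat_char_poly (K : comNzRingType) n (A : 'M[K]_n) (mu : nat -> K) :
  char_poly A = \prod_(t < n) ('X - (mu t)%:P) -> newton_mat A mu n = 0.
Proof.
case: n A => [|n] A Amu; first exact: flatmx0.
have := Cayley_Hamilton A; rewrite Amu rmorph_prod => <-.
by apply: eq_bigr => t _; rewrite rmorphB /= horner_mx_X horner_mx_C.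
Qed.

(** * Newton's form for one matrix, with any symmetric [F] obeying the recurrence *)

Section NewtonForm.
Context {R : realType}.
Local Notation C := (Cplx R).
Context (Omega : set C) (F : seq C -> C).
Hypothesis F_perm : forall s t,
  perm_eq s t -> {in s, forall z, Omega z} -> F s = F t.
Hypothesis F_rec : forall z0 z1 s,
  (z0 - z1) * F [:: z0, z1 & s] = F (z0 :: s) - F (z1 :: s).

Section OneMatrix.
Context {n : nat} (X : 'M[C]_n) (D : jordan_data X).
Hypothesis spectrum_sub : forall a, eigenvalue X a -> Omega a.

(** The nesting, eigenvalue first and then block and power, matches the sums of [gmoi], so that each
    level is split off by one use of [sum_dffun_tagged]. *)
Definition block_index (k : 'I_(jK D)) : finType :=
  {i : 'I_(geom_mult X (jlam k)) & 'I_(jm i)}.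
Definition jordan_index : finType := {k : 'I_(jK D) & block_index k}.
Implicit Type a : jordan_index.

Definition jnodes a : seq C := nseq (tagged (tagged a)).+1 (jlam (tag a)).
Definition jmat a : 'M[C]_n := jS (tag (tagged a)) (tagged (tagged a)).

Lemma jlam_Omega (k : 'I_(jK D)) : Omega (jlam k).
Proof. by apply: spectrum_sub; apply/jlam_spectrum; exists k. Qed.

Lemma jnodes_Omega a : {in jnodes a, forall z, Omega z}.
Proof. by move=> z /nseqP[-> _]; exact: jlam_Omega. Qed.

Lemma jP_mul_jS k i q : jP (j := D) (k := k) i *m jS i q = jS i q.
Proof.
case: q => [|q] /=; first exact: jP_idem.
by rewrite exprS -mulmxE mulmxA jPN.
Qed.

Lemma jN_mul_jS k i q : jN (j := D) (k := k) i *m jS i q = jS i q.+1.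
Proof. by case: q => [|q] /=; rewrite ?jNP ?expr1// [RHS]exprS. Qed.

(** On its own block [X] acts as the eigenvalue plus the nilpotent part. The other blocks are killed
    by orthogonality of projectors, their nilpotent parts too since [jNP] makes them factor through
    the projector. *)
Lemma jordan_mul_jS k (i : 'I_(geom_mult X (jlam k))) q :
  X *m jS (D := D) i q = jlam k *: jS i q + jS i q.+1.
Proof.
have off k' i' : Tagged (fun k => 'I_(geom_mult X (jlam k))) i' !=
    Tagged (fun k => 'I_(geom_mult X (jlam k))) i ->
    (jlam k' *: jP (j := D) (k := k') i' + jN i') *m jS i q = 0.
  move=> ii'; have P0 : jP i' *m jS i q = 0.
    by rewrite -(jP_mul_jS i q) mulmxA (jP_orth ii') mul0mx.
  by rewrite mulmxDl -scalemxAl P0 -(jNP i') -mulmxA P0 mulmx0 scaler0 addr0.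
transitivity (\sum_k' \sum_i'
    (jlam k' *: jP (j := D) (k := k') i' + jN i') *m jS i q).
  rewrite [LHS](congr1 (mulmx^~ (jS i q)) (jX_sum D)) mulmx_suml.
  by apply: eq_bigr => k' _; exact: mulmx_suml.
transitivity ((jlam k *: jP i + jN i) *m jS (D := D) i q); last first.
  by rewrite mulmxDl -scalemxAl jP_mul_jS jN_mul_jS.
rewrite (big_only1 k); [|by []|]; last first.
  move=> k' k'k _; apply: big1 => i' _; apply: off.
  by apply: contraNneq k'k => /(congr1 (@tag _ _)) /= ->.
rewrite (big_only1 i) => [//|//|i' i'i _].
by apply: off; rewrite eq_Tagged.
Qed.

Lemma jS_order k (i : 'I_(geom_mult X (jlam k))) : jS (D := D) i (jm i) = 0.
Proof.
(* For size 0, [jS i 0] is the projector and not a power of the nilpotent part; it vanishes by its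
   rank. *)
have [m0|m] := posnP (jm (j := D) i); last first.
  by rewrite /jS -(prednK m) prednK// jN_nilp.
by rewrite m0 /=; apply/eqP; rewrite -mxrank_eq0 jP_rank m0.
Qed.

Lemma sum_jordan_index (V : zmodType) (G : jordan_index -> V) :
  \sum_a G a = \sum_(k < jK D) \sum_(i < geom_mult X (jlam k)) \sum_(q < jm i)
    G (Tagged block_index (Tagged (fun i => 'I_(jm i)) q)).
Proof.
transitivity (\sum_(k < jK D) \sum_(b : block_index k)
    G (Tagged block_index b)).
  by rewrite sig_big_dep; apply: eq_bigr => -[].
by apply: eq_bigr => k _; rewrite sig_big_dep; apply: eq_bigr => -[].
Qed.

Definition jordan_sum s := \sum_a F (jnodes a ++ s) *: jmat a.

(** [X - mu] sends [jS i q] to [(lam - mu)] times itself plus [jS i q.+1]. The recurrence absorbs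
    the factor [lam - mu], and what remains telescopes in [G]: its upper end vanishes by [jS_order],
    its lower end is the [jP i] term. *)
Lemma jordan_block_step mu s k (i : 'I_(geom_mult X (jlam k))) :
  Omega mu -> {in s, forall z, Omega z} ->
  (X - mu%:M) *m (\sum_(q < jm i)
      F (nseq q.+1 (jlam k) ++ mu :: s) *: jS (D := D) i q) =
    \sum_(q < jm i) F (nseq q.+1 (jlam k) ++ s) *: jS i q
      - F (mu :: s) *: jP i.
Proof.
move=> Omu sO; set lam := jlam k.
pose G q := F (mu :: nseq q lam ++ s) *: jS (D := D) i q.
have Olam : Omega lam := jlam_Omega k.
have term q : (X - mu%:M) *m (F (nseq q.+1 lam ++ mu :: s) *: jS (D := D) i q) =
    F (nseq q.+1 lam ++ s) *: jS i q + (G q.+1 - G q).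
  have sO' : {in nseq q.+1 lam ++ mu :: s, forall z, Omega z}.
    move=> z; rewrite mem_cat => /orP[/nseqP[-> _]//|].
    by rewrite inE => /predU1P[->//|/sO].
  have E1 : F (nseq q.+1 lam ++ mu :: s) = F [:: lam, mu & nseq q lam ++ s].
    apply: F_perm => //.
    by rewrite perm_cons (permEl (perm_catCA (nseq q lam) [:: mu] s)).
  have E2 : F (nseq q.+1 lam ++ mu :: s) = F (mu :: nseq q.+1 lam ++ s).
    apply: F_perm => //.
    by rewrite (permEl (perm_catCA (nseq q.+1 lam) [:: mu] s)).
  rewrite -scalemxAr mulmxBl jordan_mul_jS mul_scalar_mx addrAC -scalerBl.
  rewrite scalerDr scalerA {1}E1 mulrC F_rec scalerBl E2 -/(G q.+1).
  by rewrite -/(G q) addrAC addrA.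
rewrite mulmx_sumr; under eq_bigr do rewrite term.
rewrite big_split/=; congr (_ + _).
rewrite -(big_mkord xpredT (fun q => G q.+1 - G q)) telescope_sumr//.
by rewrite /G jS_order scaler0 sub0r.
Qed.

Lemma jordan_sum_step mu s : Omega mu -> {in s, forall z, Omega z} ->
  (X - mu%:M) *m jordan_sum (mu :: s) = jordan_sum s - (F (mu :: s))%:M.
Proof.
move=> Omu sO; rewrite /jordan_sum !sum_jordan_index mulmx_sumr.
rewrite -[(F _)%:M]scalemx1 -(jP_sum D) scaler_sumr -sumrB; apply: eq_bigr => k _.
rewrite mulmx_sumr scaler_sumr -sumrB; apply: eq_bigr => i _.
exact: jordan_block_step.
Qed.

(** Newton's interpolation formula with remainder, obtained by iterating [jordan_sum_step] with the
    new node prepended to [s]. *)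
Lemma jordan_sum_newton (mu : nat -> C) m s : (forall t, Omega (mu t)) ->
  {in s, forall z, Omega z} ->
  jordan_sum s = \sum_(j < m) F (mkseq mu j.+1 ++ s) *: newton_mat X mu j +
    newton_mat X mu m *m jordan_sum (mkseq mu m ++ s).
Proof.
move=> Omu sO; elim: m => [|m IHm].
  by rewrite big_ord0 add0r /newton_mat big_ord0 mul1mx.
have mO j : {in mkseq mu j ++ s, forall z, Omega z}.
  by move=> z; rewrite mem_cat => /orP[/mapP[t _ ->]|/sO].
have perm_m : perm_eq (mkseq mu m.+1 ++ s) (mu m :: mkseq mu m ++ s).
  by rewrite mkseqS cat_rcons (permEl (perm_catCA (mkseq mu m) [:: mu m] s)).
rewrite [LHS]IHm big_ord_recr -addrA; congr (_ + _).
have -> : jordan_sum (mkseq mu m.+1 ++ s) = jordan_sum (mu m :: mkseq mu m ++ s).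
  apply: eq_bigr => a _; congr (_ *: _); apply: F_perm.
    by rewrite perm_cat2l.
  by move=> z; rewrite mem_cat => /orP[/jnodes_Omega|/mO].
rewrite [newton_mat X mu m.+1]big_ord_recr/= -/(newton_mat X mu m) -mulmxE -mulmxA.
rewrite jordan_sum_step// (F_perm perm_m)// mulmxBr mul_mx_scalar.
by rewrite addrC subrK.
Qed.

Lemma jordan_sum_char_poly (mu : nat -> C) s : (forall t, Omega (mu t)) ->
  {in s, forall z, Omega z} -> char_poly X = \prod_(t < n) ('X - (mu t)%:P) ->
  jordan_sum s = \sum_(j < n) F (mkseq mu j.+1 ++ s) *: newton_mat X mu j.
Proof.
move=> Omu sO Xmu; rewrite (jordan_sum_newton n Omu sO).
by rewrite (newton_mat_char_poly Xmu) mul0mx addr0.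
Qed.

End OneMatrix.

(** * Replacing the sums of several matrices simultaneously *)

Section MultiSum.
Context {n : nat}.

(** Common shape of the GMOI, with Jordan indices, and of its Newton form. The list [s] collects the
    nodes of factors already split off. *)
Definition multi_sum d (T : 'I_d -> finType) (L : forall p, T p -> seq C)
    (M : forall p, T p -> 'M[C]_n) s : 'M[C]_n :=
  \sum_(f : {dffun forall p, T p})
    F (s ++ flatten [seq L p (f p) | p <- enum 'I_d]) *:
    \big[mulmx/1%:M]_(p < d) M p (f p).

Lemma multi_sumS d (T : 'I_d.+1 -> finType) (L : forall p, T p -> seq C)
    (M : forall p, T p -> 'M[C]_n) s :
  multi_sum L M s = \sum_a M ord0 a *m
    multi_sum (fun p => L (lift ord0 p)) (fun p => M (lift ord0 p))
      (s ++ L ord0 a).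
Proof.
under [RHS]eq_bigr do rewrite mulmx_sumr.
rewrite -(sum_dffun_ordS (fun a (g : {dffun forall p : 'I_d, T (lift ord0 p)}) =>
  M ord0 a *m (F ((s ++ L ord0 a) ++
    flatten [seq L (lift ord0 p) (g p) | p <- enum 'I_d]) *:
    \big[mulmx/1%:M]_(p < d) M (lift ord0 p) (g p)))).
apply: eq_bigr => f _; rewrite -scalemxAr big_ord_recl enum_ordSl /=.
rewrite -map_comp -catA.
under [in RHS]eq_map do rewrite ffunE.
by under [in RHS]eq_bigr do rewrite ffunE.
Qed.

(** The factors are exchanged one by one. The coefficient couples all factors through their nodes,
    so the equality for a single factor is required for every list [s] of remaining nodes. *)
Lemma eq_multi_sum d (T T' : 'I_d -> finType)
    (L : forall p, T p -> seq C) (M : forall p, T p -> 'M[C]_n)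
    (L' : forall p, T' p -> seq C) (M' : forall p, T' p -> 'M[C]_n) s :
  (forall p a, {in L p a, forall z, Omega z}) ->
  (forall p a, {in L' p a, forall z, Omega z}) ->
  (forall p s, {in s, forall z, Omega z} ->
    \sum_a F (L p a ++ s) *: M p a = \sum_a F (L' p a ++ s) *: M' p a) ->
  {in s, forall z, Omega z} -> multi_sum L M s = multi_sum L' M' s.
Proof.
elim: d T T' L M L' M' s => [|d IHd] T T' L M L' M' s LO LO' LM sO.
  have flat0 (g : 'I_0 -> seq C) : flatten [seq g p | p <- enum 'I_0] = [::].
    by rewrite (size0nil (size_enum_ord 0)).
  by rewrite /multi_sum !(sum_dffun_ord0 (v := F s *: 1%:M))// => f;
    rewrite flat0 cats0 big_ord0.
have catO s1 s2 : {in s1, forall z, Omega z} -> {in s2, forall z, Omega z} ->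
    {in s1 ++ s2, forall z : C, Omega z}.
  by move=> O1 O2 z; rewrite mem_cat => /orP[/O1|/O2].
rewrite !multi_sumS.
pose L1 p := L' (lift ord0 p); pose M1 p := M' (lift ord0 p).
transitivity (\sum_a M ord0 a *m multi_sum L1 M1 (s ++ L ord0 a)).
  apply: eq_bigr => a _; congr (_ *m _); apply: IHd => [p b|p b|p t tO|].
  - exact: LO.
  - exact: LO'.
  - exact: LM.
  - exact: catO.
(* The sum over the first index moves innermost, and symmetry brings its nodes to the front, where
   [LM] can be applied. *)
have swap (U : finType) (l : U -> seq C) (m : U -> 'M[C]_n) :
    (forall a, {in l a, forall z, Omega z}) ->
    \sum_a m a *m multi_sum L1 M1 (s ++ l a) =
    \sum_(g : {dffun forall p : 'I_d, T' (lift ord0 p)})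
      (\sum_a F (l a ++ (s ++ flatten [seq L1 p (g p) | p <- enum 'I_d])) *: m a)
      *m \big[mulmx/1%:M]_(p < d) M1 p (g p).
  move=> lO; under eq_bigr do rewrite mulmx_sumr.
  rewrite exchange_big /=; apply: eq_bigr => g _; rewrite mulmx_suml.
  apply: eq_bigr => a _; rewrite -scalemxAr -scalemxAl; congr (_ *: _).
  apply: F_perm; first by rewrite -catA (permEl (perm_catCA _ _ _)).
  apply: (catO) => [|z /flatten_mapP[p _]]; first exact: catO.
  exact: LO'.
rewrite !swap//; apply: eq_bigr => g _; congr (_ *m _); apply: LM.
by apply: catO => // z /flatten_mapP[p _]; exact: LO'.
Qed.

End MultiSum.
End NewtonForm.

(** * Convergence of roots and of matrices *)

(** An element nearest to [a] works. Consequently a monic split polynomial that is small at [a] has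
    a root near [a]. *)
Lemma exists_dist_pow_le (K : numFieldType) (a : K) (s : seq K) : s != [::] ->
  exists2 x, x \in s & `|a - x| ^+ size s <= \prod_(y <- s) `|a - y|.
Proof.
case: s => // y s _; elim: s y => [|y' s IHs] y.
  by exists y; rewrite ?mem_head// big_seq1 expr1.
have [x xs xle] := IHs y'; rewrite big_cons.
have [xy|yx] := real_leP (normr_real (a - x)) (normr_real (a - y)).
  exists x; first by rewrite inE xs orbT.
  by rewrite exprS ler_pM// exprn_ge0.
exists y; first exact: mem_head.
rewrite exprS ler_wpM2l// (le_trans _ xle)// lerXn2r ?nnegrE//.
exact: ltW.
Qed.

(** * Continuity of the roots of monic polynomials *)

Section PolynomialConvergence.
Context {K : numFieldType} {T : Type} {F : set_system T} {FF : Filter F}.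
Implicit Types (p q : T -> {poly K}).

Definition poly_cvg p (l : {poly K}) := forall k, (p t)`_k @[t --> F] --> l`_k.

Lemma poly_cvg_cst l : poly_cvg (fun=> l) l.
Proof. by move=> k; exact: cvg_cst. Qed.

Lemma poly_cvgD p q l m : poly_cvg p l -> poly_cvg q m ->
  poly_cvg (fun t => p t + q t) (l + m).
Proof.
move=> pl qm k; under eq_fun do rewrite coefD; rewrite coefD.
by apply: cvgD; [exact: pl | exact: qm].
Qed.

Lemma poly_cvgM p q l m : poly_cvg p l -> poly_cvg q m ->
  poly_cvg (fun t => p t * q t) (l * m).
Proof.
move=> pl qm k; under eq_fun do rewrite coefM; rewrite coefM.
by apply: cvg_sumr => i; apply: cvgM; [exact: pl | exact: qm].
Qed.

Lemma poly_cvg_sum I (r : seq I) (p : T -> I -> {poly K}) (l : I -> {poly K}) :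
  (forall i, poly_cvg (p ^~ i) (l i)) ->
  poly_cvg (fun t => \sum_(i <- r) p t i) (\sum_(i <- r) l i).
Proof.
move=> pl; elim: r => [|i r IHr].
  by under eq_fun do rewrite big_nil; rewrite big_nil; exact: poly_cvg_cst.
by under eq_fun do rewrite big_cons; rewrite big_cons; exact: poly_cvgD.
Qed.

Lemma poly_cvg_prod I (r : seq I) (p : T -> I -> {poly K}) (l : I -> {poly K}) :
  (forall i, poly_cvg (p ^~ i) (l i)) ->
  poly_cvg (fun t => \prod_(i <- r) p t i) (\prod_(i <- r) l i).
Proof.
move=> pl; elim: r => [|i r IHr].
  by under eq_fun do rewrite big_nil; rewrite big_nil; exact: poly_cvg_cst.
by under eq_fun do rewrite big_cons; rewrite big_cons; exact: poly_cvgM.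
Qed.

Lemma char_poly_cvg n (A : T -> 'M[K]_n) (B : 'M[K]_n) :
  (forall i j, A t i j @[t --> F] --> B i j) ->
  poly_cvg (fun t => char_poly (A t)) (char_poly B).
Proof.
move=> AB; rewrite /char_poly /determinant; apply: poly_cvg_sum => s.
apply: poly_cvgM; first exact: poly_cvg_cst.
apply: poly_cvg_prod => i k; under eq_fun do rewrite !mxE coefB coefC.
rewrite !mxE coefB coefC; apply: cvgB; first exact: cvg_cst.
by case: eqP => _; [exact: AB | exact: cvg_cst].
Qed.

Lemma horner_cvg p l n x : poly_cvg p l -> (forall t, (size (p t) <= n)%N) ->
  (size l <= n)%N -> (p t).[x] @[t --> F] --> l.[x].
Proof.
move=> pl pn ln; rewrite (horner_coef_wide _ ln).
under eq_fun do rewrite (horner_coef_wide _ (pn _)).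
by apply: cvg_sumr => i; apply: cvgM; [exact: pl | exact: cvg_cst].
Qed.

(** The coefficients of the quotient are recovered downwards, each from the product and the next
    higher coefficient, starting from 0 at the degree bound [n]. *)
Lemma poly_cvg_div_XsubC n (x : T -> K) (a : K) q (m : {poly K}) :
  x @ F --> a -> (forall t, (size (q t) <= n)%N) -> (size m <= n)%N ->
  poly_cvg (fun t => ('X - (x t)%:P) * q t) (('X - a%:P) * m) -> poly_cvg q m.
Proof.
move=> xa qn mn qm.
have coef_succ (y : K) (r : {poly K}) k :
    r`_k = (('X - y%:P) * r)`_k.+1 + y * r`_k.+1.
  by rewrite mulrBl coefB coefXM coefCM subrK.
suff : forall d k, (n <= k + d)%N -> (q t)`_k @[t --> F] --> m`_k.
  by move=> h k; apply: (h n); rewrite leq_addl.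
elim=> [|d IHd] k; rewrite ?addn0 ?addnS => nk.
  rewrite nth_default ?(leq_trans mn)//.
  by under eq_fun do rewrite nth_default ?(leq_trans (qn _))//; exact: cvg_cst.
rewrite (coef_succ a) (_ : (fun t => _) = fun t =>
  (('X - (x t)%:P) * q t)`_k.+1 + x t * (q t)`_k.+1); last first.
  by apply: funext => t; exact: coef_succ.
by apply: cvgD; [exact: qm | apply: cvgM; [exact: xa | exact: IHd]].
Qed.

(** The polynomials tend to 0 at [a0], so a root chosen by [exists_dist_pow_le] tends to [a0];
    dividing it out leaves one root fewer. *)
Lemma roots_cvg (s : T -> seq K) (a : seq K) :
  (forall t, size (s t) = size a) ->
  poly_cvg (fun t => \prod_(x <- s t) ('X - x%:P)) (\prod_(x <- a) ('X - x%:P)) ->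
  exists2 s' : T -> seq K, forall t, perm_eq (s' t) (s t) &
    forall i, (i < size a)%N -> (s' t)`_i @[t --> F] --> a`_i.
Proof.
elim: a s => [|a0 a IHa] s sa cvs; first by exists s.
have /choice[x xs] : forall t, exists x, x \in s t /\
    `|a0 - x| ^+ (size a).+1 <= `|(\prod_(x <- s t) ('X - x%:P)).[a0]|.
  move=> t.
  have [|x xs xle] := @exists_dist_pow_le _ a0 (s t).
    by rewrite -size_eq0 sa.
  exists x; split => //; rewrite sa in xle.
  rewrite (le_trans xle)// horner_prod normr_prod.
  by under [leRHS]eq_bigr do rewrite hornerXsubC.
have xa : x @ F --> a0.
  have szs t : (size (\prod_(y <- s t) ('X - y%:P))%R <= (size a).+2)%N.
    by rewrite size_prod_XsubC sa.
  have sza : (size (\prod_(y <- a0 :: a) ('X - y%:P))%R <= (size a).+2)%N.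
    by rewrite size_prod_XsubC.
  have root0 : (\prod_(y <- a0 :: a) ('X - y%:P)).[a0] = 0.
    by apply/rootP; rewrite root_prod_XsubC mem_head.
  have : (\prod_(y <- s t) ('X - y%:P)).[a0] @[t --> F] --> (0 : K).
    by rewrite -root0; exact: horner_cvg cvs szs sza.
  move=> /cvgr0Pnorm_lt h; apply/cvgrPdist_lt => e e0.
  apply: filterS (h _ (exprn_gt0 (size a).+1 e0)) => t /(le_lt_trans (xs t).2).
  by rewrite ltr_pXn2r ?nnegrE// ltW.
pose s1 t := rem (x t) (s t).
have ss1 t : perm_eq (s t) (x t :: s1 t) by apply: perm_to_rem; case: (xs t).
have s1a t : size (s1 t) = size a by have := sa t; rewrite (perm_size (ss1 t)) => -[].
have [s2 s21 s2a] : exists2 s' : T -> seq K, forall t, perm_eq (s' t) (s1 t) &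
    forall i, (i < size a)%N -> (s' t)`_i @[t --> F] --> a`_i.
  apply: IHa => //; apply: (poly_cvg_div_XsubC (n := (size a).+1) xa).
  - by move=> t; rewrite size_prod_XsubC s1a.
  - by rewrite size_prod_XsubC.
  - move=> k; have := cvs k; rewrite big_cons.
    by under eq_fun do rewrite (perm_big _ (ss1 _)) big_cons.
exists (fun t => x t :: s2 t) => [t|[|i] /= ia].
- by rewrite perm_sym (perm_trans (ss1 t))// perm_cons perm_sym.
- exact: xa.
- exact: s2a.
Qed.

End PolynomialConvergence.

(** * Entrywise convergence of matrices *)

Section MatrixConvergence.
Context {K : numFieldType} {T : Type} {F : set_system T} {FF : Filter F}.

Definition mx_cvg m n (A : T -> 'M[K]_(m, n)) (B : 'M[K]_(m, n)) :=
  forall i j, A t i j @[t --> F] --> B i j.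

Lemma mx_cvg_cst m n (B : 'M[K]_(m, n)) : mx_cvg (fun=> B) B.
Proof. by move=> i j; exact: cvg_cst. Qed.

Lemma mx_cvgM m n k (A : T -> 'M[K]_(m, n)) A0 (B : T -> 'M[K]_(n, k)) B0 :
  mx_cvg A A0 -> mx_cvg B B0 -> mx_cvg (fun t => A t *m B t) (A0 *m B0).
Proof.
move=> AA0 BB0 i j; under eq_fun do rewrite mxE; rewrite mxE.
by apply: cvg_sumr => l; apply: cvgM; [exact: AA0 | exact: BB0].
Qed.

Lemma mx_cvgZ m n (f : T -> K) (f0 : K) (A : T -> 'M[K]_(m, n)) A0 :
  f @ F --> f0 -> mx_cvg A A0 -> mx_cvg (fun t => f t *: A t) (f0 *: A0).
Proof.
move=> ff0 AA0 i j; under eq_fun do rewrite mxE; rewrite mxE.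
by apply: cvgM; [exact: ff0 | exact: AA0].
Qed.

Lemma mx_cvg_sum m n I (r : seq I) (A : T -> I -> 'M[K]_(m, n)) A0 :
  (forall i, mx_cvg (A ^~ i) (A0 i)) ->
  mx_cvg (fun t => \sum_(i <- r) A t i) (\sum_(i <- r) A0 i).
Proof.
move=> AA0 i j; under eq_fun do rewrite summxE; rewrite summxE.
by apply: cvg_sumr => l; exact: AA0.
Qed.

Lemma mx_cvg_prod n I (r : seq I) (A : T -> I -> 'M[K]_n) A0 :
  (forall i, mx_cvg (A ^~ i) (A0 i)) ->
  mx_cvg (fun t => \big[mulmx/1%:M]_(i <- r) A t i)
    (\big[mulmx/1%:M]_(i <- r) A0 i).
Proof.
move=> AA0; elim: r => [|i r IHr] k l.
  by under eq_fun do rewrite big_nil; rewrite big_nil; exact: cvg_cst.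
under eq_fun do rewrite big_cons; rewrite big_cons.
by apply: mx_cvgM; [exact: AA0 | exact: IHr].
Qed.

Lemma newton_mat_cvg n (A : T -> 'M[K]_n) A0 (mu : T -> nat -> K)
    (mu0 : nat -> K) j :
  mx_cvg A A0 -> (forall i, mu t i @[t --> F] --> mu0 i) ->
  mx_cvg (fun t => newton_mat (A t) (mu t) j) (newton_mat A0 mu0 j).
Proof.
move=> AA0 mumu0; apply: mx_cvg_prod => i k l.
under eq_fun do rewrite !mxE; rewrite !mxE; apply: cvgB; first exact: AA0.
by case: eqP => _; [exact: mumu0 | exact: cvg_cst].
Qed.

End MatrixConvergence.

(** * Convergent enumerations of eigenvalues *)

Section EigenvalueEnumeration.
Context {K : numClosedFieldType}.

Lemma char_poly_roots n (A : 'M[K]_n) : exists2 r : seq K, size r = n &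
  char_poly A = \prod_(x <- r) ('X - x%:P).
Proof.
have [r Ar] := closed_field_poly_normal (char_poly A).
rewrite (monicP (char_poly_monic A)) scale1r in Ar; exists r => //.
by apply: eq_add_S; rewrite -(size_prod_XsubC r id) -Ar size_char_poly.
Qed.

Lemma nth_char_poly_root n (A : 'M[K]_n) (r : seq K) x0 i : size r = n ->
  char_poly A = \prod_(x <- r) ('X - x%:P) ->
  nth x0 r i = x0 \/ eigenvalue A (nth x0 r i).
Proof.
move=> rn Ar; have [ni|in_] := leqP n i; [left|right].
  by rewrite nth_default// rn.
by rewrite eigenvalue_root_char Ar root_prod_XsubC mem_nth// rn.
Qed.

Lemma char_poly_prod_nth n (A : 'M[K]_n) (r : seq K) x0 : size r = n ->
  char_poly A = \prod_(x <- r) ('X - x%:P) ->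
  char_poly A = \prod_(i < n) ('X - (nth x0 r i)%:P).
Proof. by move=> rn ->; rewrite (big_nth x0) big_mkord rn. Qed.

(* The index ranges over all of nat: past n the enumerations are constantly x0. *)
Lemma eigenvalue_enum_cvg (T : Type) (F : set_system T) {FF : Filter F} n
    (A : T -> 'M[K]_n) (B : 'M[K]_n) (x0 : K) : mx_cvg (F := F) A B ->
  exists (mu : T -> nat -> K) (mu0 : nat -> K),
    [/\ forall i, mu t i @[t --> F] --> mu0 i,
      char_poly B = \prod_(i < n) ('X - (mu0 i)%:P),
      forall t, char_poly (A t) = \prod_(i < n) ('X - (mu t i)%:P),
      forall i, mu0 i = x0 \/ eigenvalue B (mu0 i) &
      forall t i, mu t i = x0 \/ eigenvalue (A t) (mu t i)].
Proof.
move=> AB; have [b bn Bb] := char_poly_roots B.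
have /choice[s sP] : forall t, exists r : seq K, size r = n /\
    char_poly (A t) = \prod_(x <- r) ('X - x%:P).
  by move=> t; have [r] := char_poly_roots (A t); exists r.
have sb t : size (s t) = size b by rewrite bn; case: (sP t).
have cvs : poly_cvg (F := F) (fun t => \prod_(x <- s t) ('X - x%:P))
    (\prod_(x <- b) ('X - x%:P)).
  rewrite -Bb (_ : (fun t => _) = fun t => char_poly (A t)).
    exact: char_poly_cvg.
  by apply: funext => t; case: (sP t).
have [s' s's s'b] := roots_cvg sb cvs.
have s'n t : size (s' t) = n by rewrite (perm_size (s's t)) sb.
have As' t : char_poly (A t) = \prod_(x <- s' t) ('X - x%:P).
  by rewrite (perm_big _ (s's t)); case: (sP t).
exists (fun t => nth x0 (s' t)), (nth x0 b); split.
- move=> i; have [ni|in_] := leqP n i.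
    rewrite nth_default ?bn//; under eq_fun do rewrite nth_default ?s'n//.
    exact: cvg_cst.
  rewrite (set_nth_default 0) ?bn//.
  under eq_fun do rewrite (set_nth_default 0) ?s'n//.
  by apply: s'b; rewrite bn.
- exact: char_poly_prod_nth.
- by move=> t; exact: char_poly_prod_nth.
- by move=> i; exact: nth_char_poly_root.
- by move=> t i; exact: nth_char_poly_root.
Qed.

End EigenvalueEnumeration.

(** * Frobenius norm and entrywise convergence *)

Section FrobeniusNorm.
Context {R : realType} {n : nat}.
Local Notation C := (Cplx R).
Context {T : Type} {F : set_system T} {FF : Filter F}.
Implicit Type A : T -> 'M[C]_n.

(** The norm of [C] takes its values in [C]; this links it to the real modulus inside [fnorm]. *)
Lemma normr_normc (z : C) : `|z| = (Normc.normc z)%:C.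
Proof. by []. Qed.

Lemma normc_ge0 (z : C) : 0 <= Normc.normc z.
Proof. by case: z => a b; exact: sqrtr_ge0. Qed.

Lemma normc_le_fnorm (B : 'M[C]_n) i j : Normc.normc (B i j) <= fnorm B.
Proof.
rewrite -[leLHS]ger0_norm ?normc_ge0// -sqrtr_sqr ler_wsqrtr//.
rewrite (bigD1 i)//= (bigD1 j)//= -addrA lerDl addr_ge0//.
  by apply: sumr_ge0 => k _; exact: exprn_ge0 (normc_ge0 _).
apply: sumr_ge0 => k _; apply: sumr_ge0 => l _.
exact: exprn_ge0 (normc_ge0 _).
Qed.

Lemma fnorm_cvg0 A : mx_cvg (F := F) A 0 -> fnorm (A t) @[t --> F] --> (0 : R).
Proof.
move=> A0; have normc_cvg i j : Normc.normc (A t i j) @[t --> F] --> (0 : R).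
  apply/cvgr0Pnorm_lt => e e0.
  have e0' : 0 < (e%:C : C) by rewrite ltcR.
  have := A0 i j; rewrite mxE => /cvgr0Pnorm_lt/(_ _ e0').
  apply: filterS => t; rewrite normr_normc ltcR => h.
  by rewrite ger0_norm// normc_ge0.
have : \sum_i \sum_j Normc.normc (A t i j) ^+ 2 @[t --> F] -->
    \sum_(i < n) \sum_(j < n) (0 * 0 : R).
  by do 2 (apply: cvg_sumr => ?); apply: cvgM; exact: normc_cvg.
rewrite big1 => [h|i _]; last by rewrite big1// => j _; rewrite mulr0.
by rewrite -[X in _ --> X]sqrtr0; apply: continuous_cvg h; exact: sqrt_continuous.
Qed.

Lemma mx_cvg_fnorm A (B : 'M[C]_n) :
  fnorm (A t - B) @[t --> F] --> (0 : R) -> mx_cvg (F := F) A B.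
Proof.
move=> /cvgr0Pnorm_lt AB i j; apply/cvgrPdistC_lt => e e0.
(* The radius [e] is a positive element of [C], hence real, and can be compared with the real number
   [fnorm]. *)
have er : (complex.Re e)%:C = e by apply: RRe_real; exact: gtr0_real.
rewrite -er ltcR in e0; apply: filterS (AB _ e0) => t.
rewrite -[in _ < e]er normr_normc ltcR; apply: le_lt_trans.
rewrite [leRHS]ger0_norm ?sqrtr_ge0//.
by have := normc_le_fnorm (A t - B) i j; rewrite !mxE.
Qed.

End FrobeniusNorm.

(** * Newton's form of the GMOI *)

Section GmoiNewton.
Context {R : realType} {n zeta : nat}.
Local Notation C := (Cplx R).
Context (Omega : set C) (beta : C -> C).
Hypotheses (Omega_open : open Omega) (beta_analytic : analytic_on Omega beta).
Context (X : 'I_zeta.+1 -> 'M[C]_n) (D : forall p, jordan_data (X p)).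
Context (Y : 'I_zeta -> 'M[C]_n).
Hypothesis spectrum_sub : forall p a, eigenvalue (X p) a -> Omega a.

(** A matrix of [Y] precedes every factor but the first; the identity placed before that one makes
    all factors alike. *)
Definition left_factor (p : 'I_zeta.+1) : 'M[C]_n := oapp Y 1%:M (unlift ord0 p).

Lemma gmoi_multi_sum : gmoi (divdiff beta) D Y =
  multi_sum (dd beta) (T := fun p => jordan_index (D p))
    (fun p a => jnodes a) (fun p a => left_factor p *m jmat a) [::].
Proof.
rewrite /multi_sum /gmoi.
rewrite (@sum_dffun_tagged _ _ (fun p => 'I_(jK (D p)))
  (fun p => @block_index _ _ _ (D p))).
apply: eq_bigr => k _.
rewrite (@sum_dffun_tagged _ _ (fun p => 'I_(geom_mult (X p) (jlam (k p))))
  (fun p i => 'I_(jm i))).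
apply: eq_bigr => i _; apply: eq_bigr => q _.
have lamO p : Omega ((\row_p jlam (k p) : 'rV[C]_zeta.+1) 0 p).
  by rewrite mxE; exact: jlam_Omega (@spectrum_sub p) _.
(* The factorials produced by differentiation cancel those in the denominator of the GMOI. *)
rewrite (mixed_derive_divdiff Omega_open beta_analytic _ lamO).
rewrite -natr_prod mulrC mulKf; last first.
  by rewrite pnatr_eq0 -lt0n prodn_gt0// => p; exact: fact_gt0.
rewrite cat0s big_ord_recl; congr (_ *: _).
  congr (dd beta (flatten _)); apply: eq_map => p.
  by rewrite /jnodes !ffunE /= mxE.
rewrite {1}/left_factor unlift_none mul1mx /jmat !ffunE /=; congr (_ *m _).
apply: eq_bigr => p _.
by rewrite /left_factor liftK !ffunE /=.
Qed.

Lemma gmoi_newton (mu : 'I_zeta.+1 -> nat -> C) :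
  (forall p i, Omega (mu p i)) ->
  (forall p, char_poly (X p) = \prod_(i < n) ('X - (mu p i)%:P)) ->
  gmoi (divdiff beta) D Y = multi_sum (dd beta) (T := fun=> 'I_n : finType)
    (fun p j => mkseq (mu p) j.+1)
    (fun p j => left_factor p *m newton_mat (X p) (mu p) j) [::].
Proof.
move=> Omu Xmu; rewrite gmoi_multi_sum.
have F_perm := @dd_perm _ Omega beta Omega_open beta_analytic.
apply: (eq_multi_sum (Omega := Omega) F_perm) => [p a|p j z|p s sO|//].
- exact: jnodes_Omega (@spectrum_sub p) _.
- by move=> /mapP[i _ ->].
(* [left_factor] does not depend on the summation index, so it leaves both sums and the Newton form
   of a single matrix applies. *)
under eq_bigr do rewrite scalemxAr; rewrite -mulmx_sumr.
under [RHS]eq_bigr do rewrite scalemxAr; rewrite -[RHS]mulmx_sumr; congr (_ *m _).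
exact: (jordan_sum_char_poly F_perm (dd_recM beta) (D p) (@spectrum_sub p)
  (Omu p) sO (Xmu p)).
Qed.

End GmoiNewton.

(** * Passage to the limit *)

Lemma multi_sum_newton_cvg (R : realType) (n zeta : nat) (Omega : set (Cplx R))
    (beta : Cplx R -> Cplx R) (Omega_open : open Omega)
    (beta_analytic : analytic_on Omega beta) (Y : 'I_zeta -> 'M[Cplx R]_n)
    (T : Type) (F : set_system T) {FF : Filter F}
    (A : T -> 'I_zeta.+1 -> 'M[Cplx R]_n) (B : 'I_zeta.+1 -> 'M[Cplx R]_n)
    (mu : T -> 'I_zeta.+1 -> nat -> Cplx R) (mu0 : 'I_zeta.+1 -> nat -> Cplx R) :
  (forall p i, Omega (mu0 p i)) ->
  (forall p i, mu t p i @[t --> F] --> mu0 p i) ->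
  (forall p, mx_cvg (F := F) (A ^~ p) (B p)) ->
  mx_cvg (F := F)
    (fun t => multi_sum (dd beta) (T := fun=> 'I_n : finType)
      (fun p j => mkseq (mu t p) j.+1)
      (fun p j => left_factor Y p *m newton_mat (A t p) (mu t p) j) [::])
    (multi_sum (dd beta) (T := fun=> 'I_n : finType)
      (fun p j => mkseq (mu0 p) j.+1)
      (fun p j => left_factor Y p *m newton_mat (B p) (mu0 p) j) [::]).
Proof.
move=> Omu mumu AB; apply: mx_cvg_sum => f; apply: mx_cvgZ; last first.
  apply: mx_cvg_prod => p; apply: mx_cvgM; first exact: mx_cvg_cst.
  exact: newton_mat_cvg.
(* Listing the positions of the nodes makes the node list the image of a fixed list, as
   [dd_joint_continuous] requires. *)
pose l := flatten [seq [seq (p, i) | i <- iota 0 (f p).+1] | p <- enum 'I_zeta.+1].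
have lE (h : 'I_zeta.+1 -> nat -> Cplx R) :
    [::] ++ flatten [seq mkseq (h p) (f p).+1 | p <- enum 'I_zeta.+1] =
    [seq h x.1 x.2 | x <- l].
  rewrite cat0s map_flatten -[in RHS]map_comp; congr flatten; apply: eq_map => p.
  by rewrite /= -map_comp.
rewrite lE; under eq_fun do rewrite lE.
exact: (dd_joint_continuous Omega_open beta_analytic) => x _.
Qed.

(** The indices tend to infinity independently of each other; this filter expresses their joint
    limit as a single one. *)
Definition all_large (I : Type) : set_system (I -> nat) :=
  filter_from setT (fun L => [set l | forall i, (L <= l i)%N]).

#[local] Instance all_large_filter I : Filter (@all_large I).
Proof.
apply: filter_fromT_filter; first by exists 0%N.
move=> L1 L2; exists (maxn L1 L2) => l /= lL.
by split=> i; apply: leq_trans (lL i); rewrite ?leq_maxl ?leq_maxr.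
Qed.

Lemma all_large_proj (I : Type) (i : I) : l i @[l --> @all_large I] --> \oo.
Proof. by move=> P [N _ NP]; exists N => // l lN; apply: NP; exact: lN. Qed.

Theorem theorem5 (R : realType) (n zeta : nat)
  (Omega : set (Cplx R)) (beta : Cplx R -> Cplx R)
  (X : 'I_zeta.+1 -> 'M[Cplx R]_n) (Xs : 'I_zeta.+1 -> nat -> 'M[Cplx R]_n)
  (D : forall j, jordan_data (X j)) (Ds : forall j l, jordan_data (Xs j l))
  (Y : 'I_zeta -> 'M[Cplx R]_n)
  (hOmega : complex_domain Omega)
  (hbeta : analytic_on Omega beta)
  (hX : forall j a, eigenvalue (X j) a -> Omega a)
  (hXs : forall j l a, eigenvalue (Xs j l) a -> Omega a)
  (hlim : forall j, fnorm (Xs j l - X j) @[l --> \oo] --> (0 : R))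
  (hbounded : forall q : 'I_zeta.+2 -> nat, exists M : R,
     forall z : 'rV[Cplx R]_zeta.+2, (forall p, Omega (z 0 p)) ->
       Normc.normc (mixed_derive q (divdiff beta) z) <= M) :
  forall eps : R, 0 < eps ->
    exists L : nat, forall l : 'I_zeta.+1 -> nat, (forall j, (L <= l j)%N) ->
      fnorm (gmoi (divdiff beta) (fun j => Ds j (l j)) Y
             - gmoi (divdiff beta) D Y) < eps.
Proof.
case: hOmega => -[w0 Ow0] Oopen _.
have /choice[mu /choice[mu0 muP]] : forall j, exists (mu : nat -> nat -> Cplx R)
    (mu0 : nat -> Cplx R),
    [/\ forall i, mu t i @[t --> \oo] --> mu0 i,
      char_poly (X j) = \prod_(i < n) ('X - (mu0 i)%:P),
      forall t, char_poly (Xs j t) = \prod_(i < n) ('X - (mu t i)%:P),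
      forall i, Omega (mu0 i) &
      forall t i, Omega (mu t i)].
  (* Padding with [w0] keeps in [Omega] also the entries past [n], which are not eigenvalues of the
     matrices. *)
  move=> j; have [mu [mu0 [mumu X0 Xt muO mutO]]] :=
    eigenvalue_enum_cvg w0 (mx_cvg_fnorm (hlim j)).
  exists mu, mu0; split; [exact: mumu | exact: X0 | exact: Xt | |].
    by move=> i; case: (muO i) => [->//|/hX].
  by move=> t i; case: (mutO t i) => [->//|/hXs].
have GE l : gmoi (divdiff beta) (fun j => Ds j (l j)) Y =
    multi_sum (dd beta) (T := fun=> 'I_n : finType)
      (fun p j => mkseq (mu p (l p)) j.+1)
      (fun p j => left_factor Y p *m newton_mat (Xs p (l p)) (mu p (l p)) j) [::].
  apply: (gmoi_newton Oopen hbeta) => [p a|p i|p].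
  - exact: hXs.
  - by case: (muP p).
  - by case: (muP p).
have cvg_gmoi : mx_cvg (F := @all_large 'I_zeta.+1)
    (fun l => gmoi (divdiff beta) (fun j => Ds j (l j)) Y - gmoi (divdiff beta) D Y) 0.
  have GE0 := gmoi_newton Oopen hbeta D Y hX
    (fun p i => let: And5 _ _ _ h _ := muP p in h i)
    (fun p => let: And5 _ h _ _ _ := muP p in h).
  move=> i j; rewrite mxE -(subrr (gmoi (divdiff beta) D Y i j)).
  under eq_fun do rewrite !mxE.
  apply: cvgB; last exact: cvg_cst.
  under eq_fun do rewrite GE; rewrite GE0.
  apply: (multi_sum_newton_cvg Oopen hbeta (A := fun l p => Xs p (l p))
    (mu := fun l p => mu p (l p))) => [p k|p k|p u v].
  - by case: (muP p).
  - have muk : mu p t k @[t --> \oo] --> mu0 p k by case: (muP p).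
    exact: (@cvg_comp _ _ _ _ (fun t => mu p t k) _ _ _ (@all_large_proj _ p) muk).
  - have Xsk : Xs p t u v @[t --> \oo] --> X p u v.
      by move: u v; exact: mx_cvg_fnorm (hlim p).
    exact: (@cvg_comp _ _ _ _ (fun t => Xs p t u v) _ _ _ (@all_large_proj _ p) Xsk).
move=> eps eps0.
have fnorm0 : fnorm (gmoi (divdiff beta) (fun j => Ds j (l j)) Y -
    gmoi (divdiff beta) D Y) @[l --> @all_large 'I_zeta.+1] --> (0 : R).
  exact: fnorm_cvg0 cvg_gmoi.
move/cvgr0Pnorm_lt: fnorm0 => /(_ eps eps0)[L _ LP].
exists L => l lL; have := LP l lL.
by rewrite /= ger0_norm ?sqrtr_ge0.
Qed.
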